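(* Let $\alpha\ge 1$ be real and let $\rho_{AB}$ be any two-qubit state, i.e. a density operator on $\mathbb{C}^2\otimes\mathbb{C}^2$. Then its Rényi-$\alpha$ entanglement is given by $$E_\alpha(\rho_{AB})=f_\alpha\left(\mathcal{C}(\rho_{AB})\right),$$ where $\mathcal{C}(\rho_{AB})$ is the concurrence of $\rho_{AB}$ and, for $0\le x\le 1$, $$f_\alpha(x)=\frac{1}{1-\alpha}\log\left[\left(\frac{1-\sqrt{1-x^2}}{2}\right)^\alpha+\left(\frac{1+\sqrt{1-x^2}}{2}\right)^\alpha\right]\quad(\alpha\neq 1),$$ with $f_1(x)=\lim_{\alpha\to1}f_\alpha(x)=H\left(\frac12+\frac12\sqrt{1-x^2}\right)$, $H(t)=-t\log t-(1-t)\log(1-t)$.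
   Context: All logarithms are base 2, and $0\log 0=0$. For $\alpha>0$, $\alpha\ne 1$, the quantum Rényi-$\alpha$ entropy of a density operator $\rho$ is $S_\alpha(\rho)=\frac{1}{1-\alpha}\log \operatorname{tr}\rho^\alpha$; for $\alpha=1$, $S_1(\rho)=-\operatorname{tr}(\rho\log\rho)$ is the von Neumann entropy (the limit $\alpha\to1$). For a bipartite pure state (unit vector) $|\psi\rangle_{AB}$ with $\rho_A=\operatorname{tr}_B|\psi\rangle_{AB}\langle\psi|$, the Rényi-$\alpha$ entanglement is $E_\alpha(|\psi\rangle_{AB})=S_\alpha(\rho_A)$ and the concurrence is $\mathcal{C}(|\psi\rangle_{AB})=\sqrt{2(1-\operatorname{tr}\rho_A^2)}$. For a bipartite density operator $\rho_{AB}$, $E_\alpha(\rho_{AB})=\min\sum_i p_iE_\alpha(|\psi_i\rangle_{AB})$ and $\mathcal{C}(\rho_{AB})=\min\sum_i p_i\,\mathcal{C}(|\psi_i\rangle_{AB})$, each minimum being taken over all pure state decompositions $\rho_{AB}=\sum_i p_i|\psi_i\rangle_{AB}\langle\psi_i|$ (with $p_i\ge0$, $\sum_ip_i=1$, and each $|\psi_i\rangle_{AB}$ a unit vector). *)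

(* Defs.v *)
From HB Require Import structures.
From mathcomp Require Import all_boot all_order all_algebra.
From mathcomp Require Import spectral sesquilinear.
From mathcomp Require Import complex mxtens.
From mathcomp Require Import all_classical all_reals all_analysis.
From mathcomp Require Import ring lra.

Set Implicit Arguments.
Unset Strict Implicit.
Unset Printing Implicit Defensive.

Import Order.TTheory GRing.Theory Num.Theory.
Import numFieldNormedType.Exports.

Local Open Scope classical_set_scope.
Local Open Scope ring_scope.
Local Open Scope sesquilinear_scope.
Local Open Scope complex_scope.

Section Basics.
Context {R : realType}.

(* [ln 0 = 0] in the library, so [x * log2 x = 0] at [x = 0]. *)
Definition log2 (x : R) : R := ln x / ln 2.

Definition has_minimum (A : set R) : Prop := exists2 m, A m & lbound A m.

(* Meaningful only when [has_minimum A]; the value is 0 otherwise. *)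
Definition minimum (A : set R) : R := xget 0 [set m | A m /\ lbound A m].

Lemma minimumP (A : set R) :
  has_minimum A -> A (minimum A) /\ lbound A (minimum A).
Proof. by case=> m Am lm; rewrite /minimum; case: xgetP => [|/(_ m) []]. Qed.

End Basics.

Section States.
Context {R : realType}.
Notation C := R[i].

Definition density_operator n (rho : 'M[C]_n) : Prop :=
  [/\ rho \is hermsymmx,
      forall v : 'cV[C]_n, 0 <= (v ^t* *m rho *m v) 0 0
    & \tr rho = 1].

Definition unit_vector n (psi : 'cV[C]_n) : Prop := (psi ^t* *m psi) 0 0 = 1.

Definition ketbra n (psi : 'cV[C]_n) : 'M[C]_n := psi *m psi ^t*.

(* [f A] for Hermitian [A], by unitary diagonalisation: the spectral theorem
   reads [A = invmx P *m diag_mx D *m P], with [P = spectralmx A] and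
   [D = spectral_diag A], which is real when [A] is Hermitian. *)
Definition mxfun n (f : R -> R) (A : 'M[C]_n) : 'M[C]_n :=
  invmx (spectralmx A)
  *m diag_mx (map_mx (fun z : C => (f (complex.Re z))%:C) (spectral_diag A))
  *m spectralmx A.

Definition von_neumann_entropy n (rho : 'M[C]_n) : R :=
  - complex.Re (\tr (rho *m mxfun log2 rho)).

Definition renyi_entropy n (alpha : R) (rho : 'M[C]_n) : R :=
  if alpha == 1 then von_neumann_entropy rho
  else (1 - alpha)^-1
       * log2 (complex.Re (\tr (mxfun (fun x => x `^ alpha) rho))).

(* C^dA (x) C^dB is C^(dA * dB), with [mxtens_index (i, j)] as the index of the
   basis vector |i>_A |j>_B, in agreement with the library's [*t]. *)
Definition trB dA dB (M : 'M[C]_(dA * dB)) : 'M[C]_dA :=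
  \matrix_(i, j) \sum_(k < dB) M (mxtens_index (i, k)) (mxtens_index (j, k)).

Definition pure_renyi_entanglement dA dB (alpha : R)
    (psi : 'cV[C]_(dA * dB)) : R :=
  renyi_entropy alpha (trB (ketbra psi)).

Definition pure_concurrence dA dB (psi : 'cV[C]_(dA * dB)) : R :=
  let rhoA := trB (ketbra psi) in
  Num.sqrt (2 * (1 - complex.Re (\tr (rhoA *m rhoA)))).

Definition pure_decomposition n (rho : 'M[C]_n) (k : nat)
    (p : 'I_k -> R) (psi : 'I_k -> 'cV[C]_n) : Prop :=
  [/\ forall i, 0 <= p i,
      \sum_i p i = 1,
      forall i, unit_vector (psi i)
    & rho = \sum_i (p i)%:C *: ketbra (psi i)].

(* The averages of [E] over all (finite) pure state decompositions of [rho]. *)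
Definition decomposition_averages n (E : 'cV[C]_n -> R) (rho : 'M[C]_n) :
    set R :=
  [set e | exists k (p : 'I_k -> R) (psi : 'I_k -> 'cV[C]_n),
     pure_decomposition rho p psi /\ e = \sum_i p i * E (psi i)].

Definition renyi_averages dA dB (alpha : R) (rho : 'M[C]_(dA * dB)) : set R :=
  decomposition_averages (@pure_renyi_entanglement dA dB alpha) rho.

Definition concurrence_averages dA dB (rho : 'M[C]_(dA * dB)) : set R :=
  decomposition_averages (@pure_concurrence dA dB) rho.

Definition renyi_entanglement dA dB (alpha : R) (rho : 'M[C]_(dA * dB)) : R :=
  minimum (renyi_averages alpha rho).

Definition concurrence dA dB (rho : 'M[C]_(dA * dB)) : R :=
  minimum (concurrence_averages rho).

End States.

Section RenyiFunction.
Context {R : realType}.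

Definition binary_entropy (t : R) : R :=
  - (t * log2 t) - (1 - t) * log2 (1 - t).

Definition f_renyi (alpha x : R) : R :=
  if alpha == 1 then binary_entropy (1 / 2 + 1 / 2 * Num.sqrt (1 - x ^+ 2))
  else (1 - alpha)^-1
       * log2 (((1 - Num.sqrt (1 - x ^+ 2)) / 2) `^ alpha
               + ((1 + Num.sqrt (1 - x ^+ 2)) / 2) `^ alpha).

Lemma f_renyi_cvg1 (x : R) : 0 <= x <= 1 ->
  f_renyi alpha x @[alpha --> (1 : R)^'] --> f_renyi 1 x.
Proof.
move=> /andP[x0 x1].
have x2 : x ^+ 2 <= 1 by rewrite expr_le1.
set s := Num.sqrt (1 - x ^+ 2).
have s0 : 0 <= s by rewrite sqrtr_ge0.
have s1 : s <= 1.
  by rewrite -(@sqrtr1 R) ler_sqrt// gerBl sqr_ge0.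
set p := (1 - s) / 2; set q := (1 + s) / 2.
have q0 : 0 < q by rewrite /q; lra.
have pq : p + q = 1 by rewrite /p /q; lra.
have p0 : 0 <= p by rewrite /p; lra.
rewrite {2}/f_renyi eqxx -/s.
have -> : 1 / 2 + 1 / 2 * s = q by rewrite /q; lra.
have -> : binary_entropy q = - ((p * ln p + q * ln q) / ln 2).
  rewrite /binary_entropy /log2 (_ : 1 - q = p); last by lra.
  by ring.
pose g (a : R) := ln (p `^ a + q `^ a).
have g1 : g 1 = 0 by rewrite /g (powRr1 p0) (powRr1 (ltW q0)) pq ln1.
have dg : is_derive (1 : R) 1 g (p * ln p + q * ln q).
  have dq (r : R) : 0 < r -> is_derive (1 : R) 1 (fun a => r `^ a) (r * ln r).
    move=> r0.
    have -> : (fun a => r `^ a) = expR \o (fun a => a * ln r).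
      by apply/funext => a; rewrite /powR gt_eqF.
    have dl : is_derive (1 : R) 1 (fun a : R => a * ln r) (ln r).
      have -> : (fun a : R => a * ln r) = ln r *: (id : R -> R).
        by apply/funext => a /=; rewrite [RHS]mulrC.
      rewrite -[X in is_derive _ _ _ X]mulr1.
      exact: is_deriveZ.
    have de : is_derive (1 * ln r : R) 1 expR r.
      rewrite mul1r -[X in is_derive _ _ _ X](@lnK _ r) ?posrE//.
      exact: is_derive_expR.
    exact: (@is_derive1_comp R expR (fun a => a * ln r) 1 _ _ de dl).
  move: p0; rewrite le_eqVlt => /orP[/eqP p0|p0].
    have q1 : q = 1 by rewrite -p0 add0r in pq.
    rewrite -p0 q1 ln1 mul0r mulr0 addr0.
    have gE : {near (1 : R), (cst 0 : R -> R) =1 g}.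
      near=> a; rewrite /g -p0 q1 powR1 powR0 ?add0r ?ln1//.
      rewrite gt_eqF//; near: a; exact: lt_nbhsr.
    apply: (@near_eq_is_derive _ _ _ (cst 0) g) => //.
  have dsum : is_derive (1 : R) 1 (fun a => p `^ a + q `^ a)
      (p * ln p + q * ln q).
    have h := is_deriveD (dq _ p0) (dq _ q0).
    by rewrite (_ : (fun a => _) = (fun a => p `^ a) + (fun a => q `^ a)).
  have dln : is_derive (p `^ 1 + q `^ 1 : R) 1 (@ln R) 1.
    rewrite (powRr1 (ltW p0)) (powRr1 (ltW q0)) pq -[X in is_derive _ _ _ X]invr1.
    exact: is_derive1_ln.
  have := @is_derive1_comp R (@ln R) (fun a => p `^ a + q `^ a) 1 _ _ dln dsum.
  by rewrite mul1r.
case: dg => dgv dgE.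
have {dgv dgE} : (fun h : R => h^-1 * g (h + 1)) @ 0^' --> p * ln p + q * ln q.
  rewrite -dgE; apply: cvg_trans dgv; apply: near_eq_cvg; near=> h.
  by rewrite /= g1 subr0 /GRing.scale /= mulr1.
move=> /cvgrPdist_lt cvg; apply/cvgrPdist_lt => e e0.
have l2 : 0 < ln 2 :> R by rewrite ln_gt0// ltr1n.
have := cvg _ (mulr_gt0 e0 l2).
rewrite !near_withinE => cvg1.
apply/(@nbhs0P _ R _ 1); apply: filterS cvg1 => h /= cvg1 h1.
have h0 : h != 0 by apply: contra h1 => /eqP ->; rewrite addr0.
have {cvg1} := cvg1 h0; rewrite /f_renyi (negbTE h1) -/s -/p -/q /log2.
rewrite -/(g _) (addrC h).
have -> : - ((p * ln p + q * ln q) / ln 2)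
     - (1 - (1 + h))^-1 * (g (1 + h) / ln 2)
   = - ((p * ln p + q * ln q - h^-1 * g (1 + h)) / ln 2).
  have -> : 1 - (1 + h) = - h by ring.
  by rewrite invrN; field; rewrite h0 andbT gt_eqF.
suff bnd (y : R) : `|y| < e * ln 2 -> `|- (y / ln 2)| < e by exact: bnd.
by rewrite normrN normrM normfV (gtr0_norm l2) ltr_pdivrMr.
Unshelve. all: by end_near. Qed.

End RenyiFunction.

(* Main.v *)
Require Import Defs.
From mathcomp Require Import all_boot all_order all_algebra.
From mathcomp Require Import spectral sesquilinear complex mxtens.
From mathcomp Require Import all_classical all_reals all_analysis.
From mathcomp Require Import ring lra.

(** Write [rho = X X^*] and let [S] be the (symmetric) spin flip matrix, so that
    the concurrence of a pure two-qubit state [psi] is [|psi^T S psi|].  Takagi's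
    factorisation of [X^T S X] lets one choose [X] with
    [X^T S X = diag d], [d >= 0]; any other ensemble is [W = X V] with [V]
    isometric on the support of [d], whence the average concurrence of [W] is at
    least [c = d_m - \sum_(i != m) d_i], [d_m] being the largest entry.  If [c >= 0],
    multiplying the columns [i != m] of [X] by the imaginary unit and then rotating by a
    real orthogonal matrix that annihilates the diagonal of a traceless real
    symmetric matrix gives an ensemble all of whose members have concurrence
    [c]; if [c < 0], phases closing a polygon with sides [d_i], followed by a
    Hadamard matrix, give an ensemble of product states (Wootters).

    The Renyi entanglement of a pure state is [f_alpha] of its concurrence, and
    [f_alpha] is nondecreasing and convex for [alpha > 1]: in the variable [t] with
    [x = 1 / cosh t] its slope is, up to a constant, the inverse of
    [sinh t * coth (b t) + sinh t * tanh t], [b = alpha - 1], which increases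
    with [t].  Jensen's inequality then transports the optimality of the
    equal-concurrence ensemble from the concurrence to the Renyi entanglement;
    the case [alpha = 1] is the limit of Jensen's inequality. *)

Set Implicit Arguments.
Unset Strict Implicit.
Unset Printing Implicit Defensive.

Import Order.TTheory GRing.Theory Num.Theory Num.Def.
Import numFieldNormedType.Exports.

Local Open Scope classical_set_scope.
Local Open Scope ring_scope.
Local Open Scope sesquilinear_scope.

Local Notation "A ^*m" := (map_mx conjC A) (at level 2, format "A ^*m") : ring_scope.

(** * Takagi's factorisation *)

Section Takagi.
Context {C : numClosedFieldType}.

Lemma mx_conjK m n (A : 'M[C]_(m, n)) : (A^*m)^*m = A.
Proof. by apply/matrixP=> i j; rewrite !mxE conjCK. Qed.

Lemma row_normsq_ge0 n (u : 'rV[C]_n) : 0 <= (u *m u^t*) 0 0.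
Proof. by rewrite mxE sumr_ge0// => k _; rewrite !mxE mul_conjC_ge0. Qed.

Lemma row_normsq_gt0 n (u : 'rV[C]_n) : u != 0 -> 0 < (u *m u^t*) 0 0.
Proof. by move/dotmx_is_dotmx; rewrite dotmxE. Qed.

(** Symmetry makes [A *m A^*m] positive semidefinite; let [u] be a left eigenvector for [s ^+ 2].
    Then [(u *m A)^*m + s *: u] works unless it vanishes, in which case ['i *: u] does. *)
Lemma symmetric_coneigenvector n (A : 'M[C]_n.+1) : A^T = A ->
  exists (v : 'rV_n.+1) (s : C), [/\ v != 0, 0 <= s & v *m A = s *: v^*m].
Proof.
move=> sA.
have [mu /eigenvalueP[u uA u0]] := eigenvalue_closed (A *m A^*m) isT.
have mu0 : 0 <= mu.
  have := row_normsq_ge0 (u *m A).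
  rewrite trmx_mul map_mxM mulmxA sA -(mulmxA u) uA -scalemxAl mxE.
  by rewrite pmulr_lge0// row_normsq_gt0.
pose s := sqrtC mu.
have s0 : 0 <= s by rewrite sqrtC_ge0.
pose v := (u *m A)^*m + s *: u.
have vA : v *m A = s *: v^*m.
  rewrite /v map_mxD mx_conjK mulmxDl map_mxM -mulmxA.
  have -> : u^*m *m (A^*m *m A) = mu *: u^*m.
    have -> : u^*m *m (A^*m *m A) = (u *m (A *m A^*m))^*m.
      by rewrite !map_mxM mx_conjK.
    by rewrite uA map_mxZ /= geC0_conj.
  rewrite map_mxZ /= geC0_conj// scalerDr scalerA -expr2 sqrtCK -scalemxAl.
  by rewrite addrC.
have [v0|v0] := eqVneq v 0; last by exists v, s.
exists ('i *: u), s; split=> //.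
  by rewrite scaler_eq0 negb_or u0 neq0Ci.
have : (u *m A)^*m = - (s *: u) by apply/eqP; rewrite -addr_eq0; apply/eqP.
move/(congr1 (fun M => M^*m)); rewrite mx_conjK -scalemxAl => ->.
apply/matrixP => i j; rewrite !mxE !(rmorphN, rmorphM) /= conjCi (geC0_conj s0).
by ring.
Qed.

Lemma unitary_first_row n (v : 'rV[C]_n.+1) : v != 0 ->
  exists2 Q : 'M[C]_n.+1, Q \is unitarymx & exists2 a, 0 < a & v = a *: row 0 Q.
Proof.
move=> v0; pose M := col_mx v (0 : 'M[C]_(n, n.+1)).
exists (schmidt M); first by rewrite schmidt_unitarymx.
have r0 : row 0 M = v.
  by apply/rowP=> j; rewrite !mxE; case: splitP => // k _; rewrite ord1.
have : (row 0 M <= row 0 (schmidt M))%MS.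
  apply: submx_trans (row_schmidt_sub _ _) _; apply/sumsmx_subP => k.
  by rewrite leqn0 => /eqP k0; rewrite genmxE (_ : k = 0)//; apply/val_inj.
rewrite r0 => /sub_rVP[a vE]; exists a => //.
have := form1_row_schmidt M 0; rewrite r0 vE dotmxE -scalemxAl mxE.
have /row_unitarymxP/(_ 0 0) : schmidt M \is unitarymx.
  by rewrite schmidt_unitarymx.
rewrite dotmxE => ->; rewrite eqxx mulr1 le0r => /orP[/eqP a0|//].
by move: v0; rewrite vE a0 scale0r eqxx.
Qed.

(** Deflation: in a unitary basis starting with a coneigenvector, [A] splits off its coneigenvalue,
    leaving a smaller symmetric block. *)
Theorem Takagi n (A : 'M[C]_n) : A^T = A ->
  exists2 U : 'M[C]_n, U \is unitarymx &
    exists2 d : 'rV[C]_n, (forall i, 0 <= d 0 i) & U *m A *m U^T = diag_mx d.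
Proof.
elim: n A => [|n IH] A sA.
  exists 1%:M; first by apply/unitarymxP; rewrite trmx1 map_mx1 mulmx1.
  by exists 0 => [[]//|]; apply/matrixP => -[].
have [v [s [v0 s0 vA]]] := symmetric_coneigenvector sA.
have [Q uQ [a a0 vQ]] := unitary_first_row v0.
have qA : row 0 Q *m A = s *: (row 0 Q)^*m.
  apply: (scalerI (lt0r_neq0 a0)); rewrite scalemxAl -vQ vA vQ map_mxZ.
  by rewrite /= geC0_conj ?ltW// !scalerA mulrC.
have [B defB] : {B | B = Q *m A *m Q^T} by exists (Q *m A *m Q^T).
have sB : B^T = B by rewrite defB !trmx_mul trmxK sA mulmxA.
(* By the coneigenvector equation, [B 0 j] is [s] times the inner product of rows [j] and [0] of
   [Q]. *)
have B0 j : B 0 j = s *+ (j == 0).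
  have -> : B 0 j = (row 0 Q *m A *m (row j Q)^T) 0 0.
    rewrite defB -row_mul mxE [RHS]mxE; apply: eq_bigr => k _.
    by rewrite [row 0 _ _ _]mxE ![_^T _ _]mxE [row j Q _ _]mxE.
  rewrite qA -scalemxAl mxE; have /row_unitarymxP/(_ 0 j) := uQ.
  rewrite dotmxE => /(congr1 conjC) h.
  have -> : ((row 0 Q)^*m *m (row j Q)^T) 0 0 = (j == 0)%:R.
    rewrite eq_sym -[RHS]conjC_nat -h !mxE rmorph_sum; apply: eq_bigr => k _.
    by rewrite !mxE rmorphM /= conjCK.
  by rewrite mulr_natr.
pose B' : 'M[C]_n := \matrix_(i, j) B (lift 0 i) (lift 0 j).
have [|U uU [d d0 Ud]] := IH B'.
  by apply/matrixP => i j; rewrite !mxE -[in RHS]sB mxE.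
have BE : B = block_mx (s%:M : 'M[C]_1) 0 0 B' :> 'M[C]_(1 + n).
  apply/matrixP => i j; rewrite mxE; case: splitP => i' ii';
    rewrite mxE; case: splitP => j' jj'.
  - rewrite (ord1 i') (ord1 j') mxE eqxx; rewrite ord1 in ii'; rewrite ord1 in jj'.
    have -> : i = 0 by apply/val_inj.
    have -> : j = 0 by apply/val_inj.
    by rewrite B0 eqxx.
  - rewrite ord1 in ii'; rewrite mxE.
    have -> : i = 0 by apply/val_inj.
    by rewrite B0 -val_eqE/= jj'.
  - rewrite ord1 in jj'; rewrite mxE -sB mxE.
    have -> : j = 0 by apply/val_inj.
    by rewrite B0 -val_eqE/= ii'.
  - by rewrite mxE; congr (B _ _); apply/val_inj.
pose V : 'M[C]_(1 + n) := block_mx 1%:M 0 0 U.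
have uV : V \is unitarymx.
  apply/unitarymxP; rewrite tr_block_mx map_block_mx mulmx_block.
  by rewrite !(trmx0, map_mx0, trmx1, map_mx1, mul0mx, mulmx0, mulmx1,
    mul1mx, addr0, add0r) (unitarymxP uU) scalar_mx_block.
exists (V *m Q); first by rewrite mul_unitarymx.
exists (row_mx (s%:M : 'M[C]_1) d).
  by move=> i; rewrite mxE; case: splitP => j _; rewrite // ord1 mxE eqxx.
rewrite trmx_mul mulmxA -(mulmxA V) -(mulmxA V) -defB.
suff : V *m (B : 'M[C]_(1 + n)) *m V^T = diag_mx (row_mx (s%:M : 'M[C]_1) d) by [].
rewrite BE /V tr_block_mx !mulmx_block.
rewrite !(trmx0, trmx1, mul0mx, mulmx0, mulmx1, mul1mx, addr0, add0r) Ud.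
by rewrite diag_mx_row; congr (block_mx _ _ _ _);
  apply/matrixP => i j; rewrite !ord1 !mxE eqxx.
Qed.
End Takagi.

(** * Real symmetric matrices of trace zero *)

Section ZeroDiagonal.
Context {C : numClosedFieldType}.

(** Rotation in the plane of coordinates [i] and [j], given by rows so that [mxform_row] and
    bilinearity compute its congruences. *)
Definition givens n (i j : 'I_n) (a b : C) : 'M[C]_n :=
  \matrix_k (if k == i then a *: delta_mx 0 i + b *: delta_mx 0 j
             else if k == j then - b *: delta_mx 0 i + a *: delta_mx 0 j
             else delta_mx 0 k).

Definition mxform n (M : 'M[C]_n) (x y : 'rV[C]_n) : C := (x *m M *m y^T) 0 0.

Lemma mxformDl n (M : 'M[C]_n) x x' y :
  mxform M (x + x') y = mxform M x y + mxform M x' y.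
Proof. by rewrite /mxform !mulmxDl mxE. Qed.

Lemma mxformZl n (M : 'M[C]_n) a x y : mxform M (a *: x) y = a * mxform M x y.
Proof. by rewrite /mxform -!scalemxAl mxE. Qed.

Lemma mxformDr n (M : 'M[C]_n) x y y' :
  mxform M x (y + y') = mxform M x y + mxform M x y'.
Proof. by rewrite /mxform linearD /= mulmxDr mxE. Qed.

Lemma mxformZr n (M : 'M[C]_n) a x y : mxform M x (a *: y) = a * mxform M x y.
Proof. by rewrite /mxform linearZ /= -scalemxAr mxE. Qed.

Lemma mxform_delta n (M : 'M[C]_n) k l :
  mxform M (delta_mx 0 k) (delta_mx 0 l) = M k l.
Proof. by rewrite /mxform trmx_delta -rowE -colE !mxE. Qed.

Lemma mxform_row m n (G : 'M[C]_(m, n)) (M : 'M[C]_n) k l :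
  (G *m M *m G^T) k l = mxform M (row k G) (row l G).
Proof.
rewrite /mxform -row_mul mxE [RHS]mxE; apply: eq_bigr => i _.
by rewrite [row k _ _ _]mxE ![_^T _ _]mxE [row l _ _ _]mxE.
Qed.

Definition mxformE := (mxformDl, mxformDr, mxformZl, mxformZr, mxform_delta).

Lemma row_givens n (i j k : 'I_n) a b :
  row k (givens i j a b) =
  if k == i then a *: delta_mx 0 i + b *: delta_mx 0 j
  else if k == j then - b *: delta_mx 0 i + a *: delta_mx 0 j
  else delta_mx 0 k.
Proof. by rewrite rowK. Qed.

Lemma givens_orthogonal n (i j : 'I_n) a b :
  i != j -> a ^+ 2 + b ^+ 2 = 1 ->
  givens i j a b *m (givens i j a b)^T = 1%:M.
Proof.
move=> ij ab; apply/matrixP => k l.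
rewrite -[X in X *m _]mulmx1 mxform_row !row_givens.
have ji : j != i by rewrite eq_sym.
case: (eqVneq k i) => [->|ki]; [|case: (eqVneq k j) => [->|kj]];
  (case: (eqVneq l i) => [->|li]; [|case: (eqVneq l j) => [->|lj]]);
  rewrite !mxformE !mxE ?eqxx ?(negbTE ij) ?(negbTE ji) ?(negbTE ki) ?(negbTE kj)
    // ?[i == l]eq_sym ?[j == l]eq_sym ?(negbTE li) ?(negbTE lj);
  rewrite /= ?mulr1n ?mulr0n ?mulr1 ?mulr0 ?addr0 ?add0r //; by rewrite -?ab; ring.
Qed.

Lemma givens_real n (i j : 'I_n) a b : a \is Num.real -> b \is Num.real ->
  givens i j a b \is a mxOver Num.real.
Proof.
move=> ra rb; apply/mxOverP => k l; have := row_givens i j k a b.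
move/(congr1 (fun r : 'rV_n => r 0 l)); rewrite [LHS]mxE => ->.
by do 2?[case: ifP => _]; rewrite !mxE ?rpredD ?rpredM ?rpredN ?realn.
Qed.

(* [s = b / a] is a root of [M_jj s^2 + 2 M_ij s + M_ii]. *)
Lemma isotropic_rotation (p q r : C) : r \is Num.real -> 0 < p -> q < 0 ->
  exists a b, [/\ a \is Num.real, b \is Num.real, a ^+ 2 + b ^+ 2 = 1 &
    a ^+ 2 * p + 2 * a * b * r + b ^+ 2 * q = 0].
Proof.
move=> rr p0 q0.
have pr := gtr0_real p0; have qr := ltr0_real q0.
have D0 : 0 <= r ^+ 2 - q * p.
  by rewrite addr_ge0 ?real_exprn_even_ge0// oppr_ge0 nmulr_rle0 ?ltW.
set D := sqrtC (r ^+ 2 - q * p).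
have Dr : D \is Num.real by rewrite ger0_real// sqrtC_ge0.
have DE : D ^+ 2 = r ^+ 2 - q * p by rewrite sqrtCK.
pose s := - (r + D) / q.
have sr : s \is Num.real by rewrite rpredM ?rpredN ?rpredD ?rpredV.
have n0 : 0 < 1 + s ^+ 2 by rewrite ltr_pwDl// real_exprn_even_ge0.
set N := sqrtC (1 + s ^+ 2).
have N0 : 0 < N by rewrite sqrtC_gt0.
have NE : N ^+ 2 = 1 + s ^+ 2 by rewrite sqrtCK.
have Nn : N != 0 by rewrite gt_eqF.
have qn : q != 0 by rewrite lt_eqF.
exists N^-1, (s / N); split.
- by rewrite rpredV gtr0_real.
- by rewrite realM ?realV ?(gtr0_real N0).
- by rewrite expr_div_n exprVn NE -[X in X + _]mul1r -mulrDl divff ?gt_eqF.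
- rewrite expr_div_n exprVn.
  transitivity ((q * s ^+ 2 + 2 * r * s + p) / N ^+ 2); first by field.
  rewrite (_ : q * s ^+ 2 + 2 * r * s + p = 0) ?mul0r//.
  transitivity ((D ^+ 2 - (r ^+ 2 - q * p)) / q); first by rewrite /s; field.
  by rewrite DE subrr mul0r.
Qed.

(** Induction on the number of nonzero diagonal entries. Trace zero supplies a positive and a
    negative one, so the form has an isotropic direction in their plane; a rotation there kills one
    of the two entries. *)
Lemma orthogonal_zero_diag n (M : 'M[C]_n) :
  M \is a mxOver Num.real -> M^T = M -> \tr M = 0 ->
  exists O : 'M[C]_n, [/\ O \is a mxOver Num.real, O *m O^T = 1%:M
    & forall k, (O *m M *m O^T) k k = 0].
Proof.
have [m] := ubnP #|[pred k | M k k != 0]|.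
elim: m M => // m IH M; rewrite ltnS => Mm rM sM tM.
have rMk k l : M k l \is Num.real by apply/mxOverP.
case: (pickP (fun k => M k k != 0)) => [i0 Mi0|M0]; last first.
  exists 1%:M; split=> [||k]; first by apply/mxOverP => k l; rewrite mxE realn.
    by rewrite trmx1 mulmx1.
  by rewrite trmx1 mulmx1 mul1mx; apply/eqP/negbNE; rewrite M0.
have sumM : \sum_k M k k = 0 by [].
have [i Mi] : exists i, 0 < M i i.
  apply/existsP; apply: contraNT Mi0; rewrite negb_exists => /forallP M0.
  have M1 k : 0 <= - M k k by rewrite oppr_ge0 real_leNgt.
  have := sumM; move/(congr1 -%R); rewrite oppr0 -sumrN => /eqP.
  by rewrite psumr_eq0// => /allP/(_ i0); rewrite mem_index_enum oppr_eq0; apply.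
have [j Mj] : exists j, M j j < 0.
  apply/existsP; apply: contraTT Mi; rewrite negb_exists => /forallP M0.
  have M1 k : 0 <= M k k by rewrite real_leNgt.
  have := sumM => /eqP; rewrite psumr_eq0// => /allP/(_ i).
  by rewrite mem_index_enum => /(_ isT)/eqP ->; rewrite ltxx.
have ij : i != j by apply: contraTneq Mi => ->; rewrite -real_leNgt// ltW.
have [a [b [ar br ab abM]]] := isotropic_rotation (rMk i j) Mi Mj.
set G := givens i j a b.
have GG : G *m G^T = 1%:M by exact: givens_orthogonal.
have rG : G \is a mxOver Num.real by exact: givens_real.
have Gk k : (G *m M *m G^T) k k = if k == i then 0 else
    if k == j then b ^+ 2 * M i i - 2 * a * b * M i j + a ^+ 2 * M j j else M k k.
  have ji : M j i = M i j by rewrite -[in RHS]sM mxE.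
  rewrite mxform_row row_givens; case: ifP => _; last case: ifP => _;
    rewrite !mxformE ?ji //; last by ring.
  by rewrite -[RHS]abM; ring.
(* The count drops: entry [i] is now zero, and [j], the only other diagonal entry to change, was
   already counted. *)
have [||||O [rO OO OM]] := IH (G *m M *m G^T).
- apply: leq_trans Mm; apply/proper_card/fintype.properP; split.
    apply/fintype.subsetP => k; rewrite !inE Gk.
    case: (k =P i) => [_|_]; first by rewrite eqxx.
    by case: (k =P j) => // -> _; rewrite lt_eqF.
  by exists i; rewrite !inE ?Gk ?eqxx// gt_eqF.
- by rewrite !mxOverM//; apply/mxOverP => k l; rewrite mxE; apply/mxOverP.
- by rewrite !trmx_mul trmxK sM mulmxA.
- by rewrite mxtrace_mulC mulmxA (mulmx1C GG) mul1mx.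
exists (O *m G); split; first by rewrite mxOverM.
  by rewrite trmx_mul mulmxA -(mulmxA O) GG mulmx1.
by move=> k; rewrite trmx_mul !mulmxA -(OM k) !mulmxA.
Qed.
End ZeroDiagonal.

(** * Closing a quadrilateral *)

Section Polygon.
Context {C : numClosedFieldType}.
Implicit Types a b c d r : C.

(** Law of cosines: [x] is the real part of [u], and [1 - x ^+ 2] factors, as in Heron's formula,
    into terms whose signs are given by the triangle inequalities. *)
Lemma triangle_phase a b r : 0 <= a -> 0 <= b -> 0 <= r ->
  `|a - b| <= r -> r <= a + b -> exists2 u : C, `|u| = 1 & `|a + u * b| = r.
Proof.
move=> a0 b0 r0 abr rab.
have [a1|a1] := eqVneq a 0.
  exists 1; rewrite ?normr1// a1 add0r mul1r ger0_norm//; apply/eqP.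
  by move: abr rab; rewrite a1 sub0r normrN add0r ger0_norm// eq_le => -> ->.
have [b1|b1] := eqVneq b 0.
  exists 1; rewrite ?normr1// b1 mulr0 addr0 ger0_norm//; apply/eqP.
  by move: abr rab; rewrite b1 subr0 addr0 ger0_norm// eq_le => -> ->.
have ar := ger0_real a0; have br := ger0_real b0; have rr := ger0_real r0.
pose x := (r ^+ 2 - a ^+ 2 - b ^+ 2) / (2 * a * b).
have xr : x \is Num.real.
  by rewrite realM ?realV ?realB ?realX ?realM// realn.
have x1 : 0 <= 1 - x ^+ 2.
  have -> : 1 - x ^+ 2 = ((a + b) ^+ 2 - r ^+ 2) * (r ^+ 2 - (a - b) ^+ 2) /
      (2 * a * b) ^+ 2 by rewrite /x; field; rewrite a1 b1.
  have abr2 : (a - b) ^+ 2 <= r ^+ 2.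
    by rewrite -[(a - b) ^+ 2]real_normK ?realB// lerXn2r ?nnegrE.
  by rewrite divr_ge0 ?mulr_ge0 ?exprn_ge0 ?mulr_ge0 ?ler0n ?subr_ge0//
    lerXn2r ?nnegrE ?addr_ge0.
pose y := sqrtC (1 - x ^+ 2).
have yr : y \is Num.real by rewrite ger0_real// sqrtC_ge0.
have yE : y ^+ 2 = 1 - x ^+ 2 by rewrite sqrtCK.
have sq1 (z w : C) : 0 <= w -> `|z| ^+ 2 = w ^+ 2 -> `|z| = w.
  by move=> w0 /eqP; rewrite eqrXn2// => /eqP.
exists (x + 'i * y); apply: sq1 => //.
  by rewrite normC2_rect// yE; ring.
have -> : a + (x + 'i * y) * b = (a + x * b) + 'i * (y * b) by ring.
have abx : a + x * b \is Num.real by rewrite realD// realM.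
rewrite normC2_rect// ?realM// exprMn yE /x; field.
by rewrite a1 b1.
Qed.

(** A diagonal of length [r] cuts the quadrilateral into triangles with sides [a, b, r] and
    [c, d, r]; the phase [z] turns the second so that the two sums cancel. *)
Lemma quadrilateral_phases a b c d : 0 <= a -> 0 <= b -> 0 <= c -> 0 <= d ->
  a <= b + c + d -> b <= a + c + d -> c <= a + b + d -> d <= a + b + c ->
  exists u v w : C, [/\ `|u| = 1, `|v| = 1, `|w| = 1 &
    a + u * b + v * c + w * d = 0].
Proof.
move=> a0 b0 c0 d0 ha hb hc hd.
have ar := ger0_real a0; have br := ger0_real b0.
have cr := ger0_real c0; have dr := ger0_real d0.
have nB x y z : x \is Num.real -> y \is Num.real -> x <= y + z -> y <= x + z ->
    `|x - y| <= z.
  move=> xr yr xyz yxz; rewrite real_ler_norml ?realB// lerBlDl xyz andbT.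
  by rewrite lerBrDr addrC lerBlDr.
have nD x y : 0 <= x -> 0 <= y -> `|x - y| <= x + y.
  move=> x0 y0; apply: nB; rewrite ?ger0_real//.
    by rewrite addrCA lerDl addr_ge0.
  by rewrite addrA lerDr addr_ge0.
suff [r [r0 [h1 h2 h3 h4]]] : exists r, 0 <= r /\
    [/\ `|a - b| <= r, r <= a + b, `|c - d| <= r & r <= c + d].
  have [u u1 uE] := triangle_phase a0 b0 r0 h1 h2.
  have [w w1 wE] := triangle_phase c0 d0 r0 h3 h4.
  have [r1|r1] := eqVneq r 0.
    exists u, 1, w; rewrite normr1; split=> //.
    move/eqP: uE; rewrite r1 normr_eq0 => /eqP ->.
    by move/eqP: wE; rewrite r1 normr_eq0 mul1r add0r => /eqP ->.
  have cd : c + w * d != 0 by rewrite -normr_eq0 wE.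
  pose z := - (a + u * b) / (c + w * d).
  have z1 : `|z| = 1 by rewrite normrM normrN normfV uE wE divff.
  exists u, z, (z * w); rewrite (normrM z w) z1 w1 mulr1; split=> //.
  by rewrite /z; field.
have abcd : `|a - b| <= c + d by apply: nB; rewrite // addrA.
have cdab : `|c - d| <= a + b.
  by apply: nB => //; rewrite addrC.
have := real_leVge (normr_real (a - b)) (normr_real (c - d)).
by case/orP => h; [exists (`|c - d|)|exists (`|a - b|)]; rewrite normr_ge0 ?lexx ?h ?nD.
Qed.
End Polygon.

(** * Optimal ensembles *)

Section Wootters.
Context {C : numClosedFieldType}.

Lemma psd_factor n (rho : 'M[C]_n) : rho \is hermsymmx ->
  (forall v : 'cV[C]_n, 0 <= (v ^t* *m rho *m v) 0 0) ->
  exists X : 'M[C]_n, rho = X *m X ^t*.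
Proof.
move=> /hermitian_normalmx/orthomx_spectralP.
set P := spectralmx rho; set D := spectral_diag rho => rhoE pos.
have uP : P \is unitarymx by exact: spectral_unitarymx.
rewrite invmx_unitary// in rhoE.
have D0 i : 0 <= D 0 i.
  have := pos (P^t* *m delta_mx i 0).
  rewrite rhoE trmx_mul map_mxM trmxCK !mulmxA mulmxtVK//.
  rewrite -(mulmxA _ P) (unitarymxP uP) mulmx1.
  rewrite trmx_delta map_delta_mx -mulmxA -colE -rowE !mxE eqxx mulr1n //.
exists (P^t* *m diag_mx (map_mx sqrtC D)).
rewrite trmx_mul map_mxM trmxCK tr_diag_mx map_diag_mx !mulmxA {1}rhoE.
congr (_ *m _); rewrite -!mulmxA mulmx_diag; congr (_ *m diag_mx _).
by apply/rowP => i; rewrite !mxE /= geC0_conj ?sqrtC_ge0// -expr2 sqrtCK.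
Qed.

(** A unitary on the right of [X] preserves [X *m X^t*] and acts on [X^T *m S *m X] by congruence;
    Takagi's theorem supplies the right one. *)
Lemma takagi_factor n (rho S : 'M[C]_n) : rho \is hermsymmx ->
  (forall v : 'cV[C]_n, 0 <= (v ^t* *m rho *m v) 0 0) -> S^T = S ->
  exists (X : 'M[C]_n) (d : 'rV[C]_n), [/\ forall i, 0 <= d 0 i,
    rho = X *m X^t* & X^T *m S *m X = diag_mx d].
Proof.
move=> hrho pos sS; have [X ->] := psd_factor hrho pos.
have [|U uU [d d0 Ud]] := @Takagi C _ (X^T *m S *m X).
  by rewrite !trmx_mul trmxK sS mulmxA.
exists (X *m U^T), d; split=> //.
  have := uU; rewrite -trmx_unitary => uUT.
  by rewrite trmx_mul map_mxM mulmxA mulmxtVK.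
by rewrite trmx_mul trmxK -Ud !mulmxA.
Qed.

Lemma mul_adj_eq0 m n (M : 'M[C]_(m, n)) : M *m M^t* = 0 -> M = 0.
Proof.
move=> MM; apply/row_matrixP => i; rewrite row0; apply/eqP/negPn/negP.
move=> /dotmx_is_dotmx; rewrite dotmxE.
have -> : (row i M *m (row i M)^t*) 0 0 = (M *m M^t*) i i.
  by rewrite !mxE; apply: eq_bigr => k _; rewrite !mxE.
by rewrite MM mxE ltxx.
Qed.

(** If [Y *m X = 0] then [Y *m W *m W^t* *m Y^t* = 0], so [Y *m W = 0]; hence the columns of [W] lie
    in the span of those of [X]. *)
Lemma factor_through n p q (X : 'M[C]_(n, p)) (W : 'M[C]_(n, q)) :
  W *m W^t* = X *m X^t* -> exists V : 'M[C]_(p, q), W = X *m V.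
Proof.
move=> WX; suff /submxP[D WD] : (W^T <= X^T)%MS.
  by exists D^T; apply: trmx_inj; rewrite trmx_mul trmxK.
pose Y := (cokermx X^T)^T.
have YX : Y *m X = 0 by apply: trmx_inj; rewrite trmx_mul trmxK mulmx_coker trmx0.
have YW : Y *m W = 0.
  apply: mul_adj_eq0.
  by rewrite trmx_mul map_mxM mulmxA -(mulmxA Y) WX mulmxA YX !mul0mx.
by rewrite submxE -[cokermx _]trmxK -trmx_mul YW trmx0.
Qed.

(* [X^+ W = P V] with [P = X^+ X]; whatever the generalised inverse [X^+], the
   rows [i] of [P] with [d_i != 0] are those of the identity matrix. *)
Lemma factor_weights n K (X S : 'M[C]_n) (d : 'rV[C]_n) (W : 'M[C]_(n, K)) :
  (forall i, 0 <= d 0 i) -> X^T *m S *m X = diag_mx d ->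
  W *m W^t* = X *m X^t* ->
  exists2 V : 'M[C]_(n, K), W = X *m V &
    forall i, \sum_k d 0 i * `|V i k| ^+ 2 = d 0 i.
Proof.
move=> d0 XSX WX; have [V0 WV0] := factor_through WX.
pose Y := (pinvmx X^T)^T; pose P := Y *m X.
have XP : X *m P = X.
  apply: trmx_inj; rewrite !trmx_mul trmxK.
  by rewrite mulmxKpV.
pose V := P *m V0.
have WV : W = X *m V by rewrite /V mulmxA XP.
have dP : diag_mx d *m P = diag_mx d by rewrite -XSX -!mulmxA XP.
have VV : V *m V^t* = P *m P^t*.
  have -> : V = Y *m W by rewrite WV0 mulmxA.
  by rewrite trmx_mul map_mxM mulmxA -(mulmxA Y) WX /P trmx_mul map_mxM !mulmxA.
exists V => // i.
have : (diag_mx d *m (V *m V^t*)) i i = (diag_mx d *m P^t*) i i.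
  by rewrite VV mulmxA dP.
have dE m (M : 'M[C]_(n, m)) j : (diag_mx d *m M) i j = d 0 i * M i j.
  by rewrite mul_diag_mx mxE.
rewrite !dE [_^*m _ _]mxE [P^T _ _]mxE.
have dPi : d 0 i * P i i = d 0 i.
  by have /matrixP/(_ i i) := dP; rewrite mul_diag_mx !mxE eqxx mulr1n.
have -> : d 0 i * (P i i)^* = d 0 i.
  by rewrite -[X in X * _](geC0_conj (d0 i)) -rmorphM /= dPi geC0_conj.
move=> dV; rewrite -[RHS]dV mxE big_distrr; apply: eq_bigr => k _.
by rewrite normCK [_^*m _ _]mxE [V^T _ _]mxE.
Qed.

(** Column [k] has overlap [\sum_i d 0 i * V i k ^+ 2]. The reverse triangle inequality isolates the
    term [m], and [factor_weights] evaluates the sums over [k]. *)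
Lemma concurrence_lower_bound n K (X S : 'M[C]_n) (d : 'rV[C]_n)
    (W : 'M[C]_(n, K)) (m : 'I_n) :
  (forall i, 0 <= d 0 i) -> X^T *m S *m X = diag_mx d ->
  W *m W^t* = X *m X^t* ->
  d 0 m - \sum_(i | i != m) d 0 i <= \sum_k `|(W^T *m S *m W) k k|.
Proof.
move=> d0 XSX WX; have [V WV dV] := factor_weights d0 XSX WX.
have Wk k : (W^T *m S *m W) k k = \sum_i d 0 i * V i k ^+ 2.
  rewrite WV trmx_mul -!mulmxA (mulmxA X^T) (mulmxA (X^T *m S)) XSX mul_diag_mx !mxE.
  by apply: eq_bigr => i _; rewrite !mxE mulrCA -expr2.
rewrite -(dV m) -(eq_bigr _ (fun i _ => dV i)) exchange_big -sumrB /=.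
apply: ler_sum => k _; rewrite Wk [X in _ <= `|X|](bigD1 m)//= -[X in _ <= `|_ + X|]opprK.
apply: le_trans (lerB_dist _ _); rewrite normrN normrM normrX (ger0_norm (d0 m)).
rewrite lerB//; apply: le_trans (ler_norm_sum _ _ _) _.
by apply: ler_sum => i _; rewrite normrM normrX ger0_norm.
Qed.

Lemma phases_factor n (X S : 'M[C]_n) (d e : 'rV[C]_n) (Y := X *m diag_mx e) :
  (forall i, `|e 0 i| = 1) -> X^T *m S *m X = diag_mx d ->
  Y *m Y^t* = X *m X^t* /\
  Y^T *m S *m Y = diag_mx (\row_i (e 0 i ^+ 2 * d 0 i)).
Proof.
move=> e1 XSX; split.
  rewrite trmx_mul map_mxM tr_diag_mx map_diag_mx mulmxA -(mulmxA X) mulmx_diag.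
  suff -> : \row_j (e 0 j * e^*m 0 j) = const_mx 1 by rewrite diag_const_mx mulmx1.
  by apply/rowP => j; rewrite !mxE -normCK e1 expr1n.
rewrite trmx_mul tr_diag_mx -!mulmxA (mulmxA X^T) (mulmxA (X^T *m S)) XSX !mulmx_diag.
by congr diag_mx; apply/rowP => j; rewrite !mxE; ring.
Qed.

(** The phase ['i] flips the sign of all entries but [d 0 m], so [diag_mx t] has trace [c].
    Subtracting [c] times the real part of the Gram matrix, of trace 1, leaves a traceless real
    symmetric matrix; rotating its diagonal to zero equates each overlap with [c] times a squared
    norm. *)
Lemma equal_ratio_pos n (X S : 'M[C]_n) (d : 'rV[C]_n) (m : 'I_n) :
  \tr (X *m X^t*) = 1 -> (forall i, 0 <= d 0 i) -> X^T *m S *m X = diag_mx d ->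
  let c := d 0 m - \sum_(i | i != m) d 0 i in 0 <= c ->
  exists2 Z : 'M[C]_n, Z *m Z^t* = X *m X^t* &
    forall k, `|(Z^T *m S *m Z) k k| = c * (Z^t* *m Z) k k.
Proof.
move=> trX d0 XSX c c0.
pose e : 'rV[C]_n := \row_i (if i == m then 1 else 'i).
pose t : 'rV[C]_n := \row_i (if i == m then d 0 i else - d 0 i).
have e1 i : `|e 0 i| = 1 by rewrite mxE; case: ifP => _; rewrite ?normr1 ?normCi.
have [YY] := phases_factor e1 XSX; set Y := X *m _ in YY *.
have -> : \row_i (e 0 i ^+ 2 * d 0 i) = t.
  apply/rowP => j; rewrite !mxE; case: ifP => _; first by rewrite expr1n mul1r.
  by rewrite sqrCi mulN1r.
move=> YSY.
pose G := Y^t* *m Y.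
have GT : G^T = G^*m by rewrite /G trmx_mul map_mxM mx_conjK map_trmx trmxK.
pose ReG : 'M[C]_n := 2^-1 *: (G + G^*m).
have [||| O [rO OO OM]] := @orthogonal_zero_diag C n (diag_mx t - c *: ReG).
- apply/mxOverP => i j; rewrite !mxE realB//.
    by apply: rpredMn; case: ifP => _; rewrite ?realN ger0_real.
  rewrite realM ?(ger0_real c0)// realM ?realV ?realn//.
  by apply/CrealP; rewrite rmorphD /= conjCK addrC.
- rewrite linearB /= tr_diag_mx /ReG !linearZ /= linearD /= GT.
  by rewrite map_trmx GT mx_conjK (addrC G).
- have trG : \tr G = 1 by rewrite mxtrace_mulC YY.
  have trReG : \tr ReG = 1.
    by rewrite /ReG mxtraceZ mxtraceD trace_map_mx /= trG conjC1; field.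
  rewrite raddfB /= mxtraceZ trReG mulr1 mxtrace_diag (bigD1 m)//= mxE eqxx.
  rewrite (eq_bigr (fun i => - d 0 i)); last by move=> i /negbTE im; rewrite mxE im.
  by rewrite sumrN subrr.
have OC : O^*m = O by apply: realmxC.
have OTO : O^T *m O = 1%:M by exact: mulmx1C.
exists (Y *m O^T).
  rewrite trmx_mul trmxK map_mxM OC mulmxA -(mulmxA Y) OTO mulmx1; exact: YY.
move=> k; set Z := Y *m O^T.
have ZZ : Z^t* *m Z = O *m G *m O^T.
  by rewrite /Z trmx_mul trmxK map_mxM OC /G !mulmxA.
have ZSZ : Z^T *m S *m Z = O *m diag_mx t *m O^T.
  by rewrite /Z trmx_mul trmxK -YSY !mulmxA.
have ZZ0 : 0 <= (Z^t* *m Z) k k.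
  by rewrite mxE sumr_ge0// => i _; rewrite !mxE mulrC mul_conjC_ge0.
suff -> : (Z^T *m S *m Z) k k = c * (Z^t* *m Z) k k.
  by rewrite ger0_norm// mulr_ge0.
have := OM k; rewrite mulmxBr mulmxBl -scalemxAr -scalemxAl mxE -ZSZ.
move/eqP; rewrite [(- _ : 'M[C]_n) k k]mxE subr_eq0 => /eqP ->.
rewrite [LHS]mxE; congr (_ * _).
(* A Gram matrix has a real diagonal, which passing to the real part does not alter. *)
rewrite /ReG -scalemxAr -scalemxAl mulmxDr mulmxDl.
have -> : O *m G^*m *m O^T = (O *m G *m O^T)^*m.
  by rewrite [RHS]map_mxM [X in _ = X *m _]map_mxM -map_trmx OC.
rewrite -ZZ mxE [(_ + _ : 'M[C]_n) k k]mxE [_^*m k k]mxE [conjC _]geC0_conj//.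
by field.
Qed.

(** The exponent is the scalar product of the binary digits of [k] and [l]. *)
Definition hadamard4 : 'M[C]_4 :=
  \matrix_(k, l) (2^-1 * (-1) ^+ ((odd k && odd l) (+) ((1 < k) && (1 < l))%N)).

Lemma hadamard4_real : hadamard4 ^*m = hadamard4.
Proof.
apply/realmxC/mxOverP => k l.
by rewrite mxE realM ?realV ?realn// rpredX// rpredN real1.
Qed.

Lemma hadamard4_orthogonal : hadamard4 ^T *m hadamard4 = 1%:M.
Proof.
apply/matrixP => -[[|[|[|[|//]]]] ?] [[|[|[|[|//]]]] ?];
  rewrite !mxE !big_ord_recl big_ord0 !mxE /= ?expr0 ?expr1 ?mulr1n ?mulr0n; by field.
Qed.

Lemma hadamard4_sqr k l : hadamard4 k l ^+ 2 = 4^-1.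
Proof. by rewrite mxE exprMn sqrr_sign mulr1; field. Qed.

Lemma sqrt_phase (u : C) : `|u| = 1 -> exists2 e : C, `|e| = 1 & e ^+ 2 = u.
Proof.
move=> u1; exists (sqrtC u); last exact: sqrtCK.
by apply/eqP; rewrite -(@pexpr_eq1 _ _ 2)// -normrX sqrtCK u1.
Qed.

(** No side exceeds the sum of the others, so phases close the polygon. After the Hadamard rotation
    each diagonal entry is a quarter of the vanishing sum. *)
Lemma equal_ratio_zero (X S : 'M[C]_4) (d : 'rV[C]_4) :
  (forall i, 0 <= d 0 i) -> X^T *m S *m X = diag_mx d ->
  (forall m, d 0 m <= \sum_(i | i != m) d 0 i) ->
  exists2 Z : 'M[C]_4, Z *m Z^t* = X *m X^t* &
    forall k, (Z^T *m S *m Z) k k = 0.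
Proof.
move=> d0 XSX dm.
have [e e1 ed] : exists2 e : 'rV[C]_4, forall i, `|e 0 i| = 1 &
    \sum_i e 0 i ^+ 2 * d 0 i = 0.
  pose o k : 'I_4 := inord k.
  have oE : (forall i : 'I_4, i = o i) by move=> i; rewrite /o inord_val.
  have S4 (f : 'I_4 -> C) : \sum_i f i = f (o 0%N) + f (o 1%N) + f (o 2) + f (o 3).
    rewrite !big_ord_recl big_ord0 addr0 !addrA.
    by do !congr (_ + _); congr f; apply/val_inj; rewrite /= inordK.
  have oo k l : (k < 4)%N -> (l < 4)%N -> (o k == o l) = (k == l).
    by move=> k4 l4; rewrite -val_eqE /= !inordK.
  have dmE m : (m < 4)%N -> d 0 (o m) <= (if 0%N == m then 0 else d 0 (o 0%N)) +
      (if 1%N == m then 0 else d 0 (o 1%N)) + (if 2 == m then 0 else d 0 (o 2)) +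
      (if 3 == m then 0 else d 0 (o 3)).
    move=> m4; by apply: le_trans (dm _) _; rewrite big_mkcond S4 !oo// !if_neg.
  have := dmE 0%N isT; have := dmE 1%N isT; have := dmE 2 isT; have := dmE 3 isT.
  rewrite /= !add0r !addr0 => d3 d2 d1 d00.
  have [u [v [w [u1 v1 w1 uvw]]]] :=
    quadrilateral_phases (d0 (o 0%N)) (d0 (o 1%N)) (d0 (o 2)) (d0 (o 3)) d00 d1 d2 d3.
  (* Square roots, because a phase on a column of [X] acts on [d] through its square. *)
  have [e1 e11 e1E] := sqrt_phase u1.
  have [e2 e21 e2E] := sqrt_phase v1.
  have [e3 e31 e3E] := sqrt_phase w1.
  exists (\row_i nth 1 [:: 1; e1; e2; e3] i).
    by case=> -[|[|[|[|//]]]] ?; rewrite mxE ?normr1.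
  by rewrite S4 !mxE !inordK//= expr1n mul1r e1E e2E e3E.
have [YY YSY] := phases_factor e1 XSX; set Y := X *m _ in YY YSY.
have HH := hadamard4_orthogonal.
exists (Y *m hadamard4^T).
  rewrite trmx_mul trmxK map_mxM hadamard4_real mulmxA -(mulmxA Y) HH mulmx1.
  exact: YY.
move=> k; set Z := Y *m _.
have -> : Z^T *m S *m Z = hadamard4 *m (Y^T *m S *m Y) *m hadamard4^T.
  by rewrite /Z trmx_mul trmxK !mulmxA.
rewrite YSY -mulmxA mul_diag_mx mxE -[RHS](mulr0 4^-1) -[X in _ = _ * X]ed big_distrr /=.
apply: eq_bigr => i _; rewrite -(hadamard4_sqr k i) [X in _ * X]mxE.
by rewrite [(\row__ _) 0 i]mxE [hadamard4^T _ _]mxE; ring.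
Qed.

(** The condition on [Z] says that its nonzero columns, once normalised, all have overlap of modulus
    [c]; as their squared norms sum to 1, the lower bound is attained. *)
Theorem optimal_ensemble (rho S : 'M[C]_4) : rho \is hermsymmx ->
  (forall v : 'cV[C]_4, 0 <= (v ^t* *m rho *m v) 0 0) -> \tr rho = 1 ->
  S^T = S ->
  exists c : C, [/\ 0 <= c,
    exists2 Z : 'M[C]_4, Z *m Z^t* = rho &
      forall k, `|(Z^T *m S *m Z) k k| = c * (Z^t* *m Z) k k &
    forall K (W : 'M[C]_(4, K)), W *m W^t* = rho ->
      c <= \sum_k `|(W^T *m S *m W) k k|].
Proof.
move=> hrho pos trho sS.
have [X [d [d0 XX XSX]]] := takagi_factor hrho pos sS.
pose c m := d 0 m - \sum_(i | i != m) d 0 i.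
have [[m /negPf cm]|cneg] := pselect (exists m, ~~ (d 0 m <= \sum_(i | i != m) d 0 i)).
  exists (c m); have c0 : 0 <= c m.
    by rewrite subr_ge0 ltW// real_ltNge ?ger0_real ?sumr_ge0// cm.
  split=> //; first by rewrite XX; apply: equal_ratio_pos; rewrite -?XX.
  by move=> K W; rewrite XX; exact: concurrence_lower_bound.
exists 0; split=> //; last by move=> K W _; rewrite sumr_ge0.
have [m|Z ZZ Z0] := equal_ratio_zero d0 XSX.
  by apply/negPn/negP => h; apply: cneg; exists m.
by exists Z => [|k]; rewrite ?XX// Z0 normr0 mul0r.
Qed.
End Wootters.

(** * Hyperbolic estimates *)

Section Hyperbolic.
Context {R : realType}.
Implicit Types (f g : R -> R) (x t : R).

Lemma derivative_nondecreasing f f' (a b : R) : a <= b ->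
  (forall x, a <= x <= b -> is_derive x 1 f (f' x)) ->
  (forall x, a <= x <= b -> 0 <= f' x) -> f a <= f b.
Proof.
rewrite le_eqVlt => /predU1P[-> //|ab] df f0.
have [||c] := @MVT R f f' a b ab.
- by move=> x; rewrite in_itv /= => /andP[/ltW ax /ltW xb]; apply: df; rewrite ax.
- apply: derivable_within_continuous => x; rewrite in_itv /= => axb.
  by have := df x axb => d; exact: ex_derive.
rewrite in_itv /= => /andP[/ltW ac /ltW cb] fE.
by rewrite -subr_ge0 fE mulr_ge0 ?subr_ge0 ?f0 ?ac// ltW.
Qed.

(* Twice the usual hyperbolic functions. *)
Definition dcosh t := expR t + expR (- t).
Definition dsinh t := expR t - expR (- t).

Lemma is_derive_expR_scale a x :
  is_derive x 1 (fun t : R => expR (a * t)) (a * expR (a * x)).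
Proof.
have dl : is_derive x 1 (fun t : R => a * t) a.
  have -> : (fun t : R => a * t) = a *: (id : R -> R) by apply/funext.
  rewrite -[X in is_derive _ _ _ X]mulr1; exact: is_deriveZ.
rewrite mulrC; exact: (@is_derive1_comp R expR (fun t => a * t)).
Qed.

Lemma is_derive_dcosh a x :
  is_derive x 1 (fun t : R => dcosh (a * t)) (a * dsinh (a * x)).
Proof.
have -> : (fun t : R => dcosh (a * t)) =
    (fun t => expR (a * t)) + (fun t => expR (- a * t)).
  by apply/funext => t; rewrite /dcosh fctE mulNr.
have -> : a * dsinh (a * x) = a * expR (a * x) + (- a) * expR (- a * x).
  by rewrite /dsinh mulrBr !mulNr.
exact: is_deriveD (is_derive_expR_scale a x) (is_derive_expR_scale (- a) x).
Qed.

Lemma is_derive_dsinh a x :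
  is_derive x 1 (fun t : R => dsinh (a * t)) (a * dcosh (a * x)).
Proof.
have -> : (fun t : R => dsinh (a * t)) =
    (fun t => expR (a * t)) - (fun t => expR (- a * t)).
  by apply/funext => t; rewrite /dsinh -mulNr.
have -> : a * dcosh (a * x) = a * expR (a * x) - (- a) * expR (- a * x).
  by rewrite /dcosh mulrDr !mulNr opprK.
exact: is_deriveB (is_derive_expR_scale a x) (is_derive_expR_scale (- a) x).
Qed.

Lemma is_derive_dcosh1 x : is_derive x 1 dcosh (dsinh x).
Proof.
have := is_derive_dcosh 1 x; rewrite !mul1r.
by under eq_fun do rewrite mul1r.
Qed.

Lemma is_derive_dsinh1 x : is_derive x 1 dsinh (dcosh x).
Proof.
have := is_derive_dsinh 1 x; rewrite !mul1r.
by under eq_fun do rewrite mul1r.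
Qed.

Lemma dcosh_gt0 t : 0 < dcosh t.
Proof. by rewrite addr_gt0 ?expR_gt0. Qed.

Lemma dsinh0 : dsinh 0 = 0.
Proof. by rewrite /dsinh oppr0 subrr. Qed.

Lemma dsinh_ge0 t : 0 <= t -> 0 <= dsinh t.
Proof. by move=> t0; rewrite subr_ge0 ler_expR; lra. Qed.

Lemma dsinh_gt0 t : 0 < t -> 0 < dsinh t.
Proof. by move=> t0; rewrite subr_gt0 ltr_expR; lra. Qed.

Lemma dcosh_ge2 t : 2 <= dcosh t.
Proof. have := expR_ge1Dx t; have := expR_ge1Dx (- t); rewrite /dcosh; lra. Qed.

Lemma dsinh_ge t : 0 <= t -> 2 * t <= dsinh t.
Proof.
move=> t0; rewrite -subr_ge0.
have {1}-> : 0 = dsinh 0 - 2 * 0 by rewrite dsinh0; ring.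
apply: (@derivative_nondecreasing (fun t => dsinh t - 2 * t)
  (fun t => dcosh t - 2)) => // x _.
  have d2 : is_derive x 1 (fun t : R => 2 * t) 2.
    have -> : (fun t : R => 2 * t) = 2 *: (id : R -> R) by apply/funext.
    rewrite -[X in is_derive _ _ _ X]mulr1; exact: is_deriveZ.
  exact: (is_deriveB (is_derive_dsinh1 x) d2).
by rewrite subr_ge0 dcosh_ge2.
Qed.

Lemma dsinh_le t : 0 <= t -> dsinh t <= t * dcosh t.
Proof.
move=> t0; rewrite -subr_ge0.
have {1}-> : 0 = 0 * dcosh 0 - dsinh 0 by rewrite dsinh0; ring.
apply: (@derivative_nondecreasing (fun t => t * dcosh t - dsinh t)
  (fun t => t * dsinh t)) => // x /andP[x0 _]; last by rewrite mulr_ge0 ?dsinh_ge0.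
have h := is_deriveB (is_deriveM (is_derive_id x 1) (is_derive_dcosh1 x))
  (is_derive_dsinh1 x).
apply: (is_derive_eq h); rewrite /GRing.scale /=; ring.
Qed.

Lemma dcosh_dsinh_double t : dcosh t * dsinh t = dsinh (2 * t).
Proof.
rewrite /dcosh /dsinh (_ : 2 * t = t + t); last by ring.
by rewrite opprD !expRD; ring.
Qed.

Lemma dcosh2_dsinh2 t : dcosh t ^+ 2 - dsinh t ^+ 2 = 4.
Proof.
have e : expR t * expR (- t) = 1 by rewrite expRN divff// gt_eqF ?expR_gt0.
by rewrite /dcosh /dsinh; ring: e.
Qed.

Lemma dcoshD s t : 2 * dcosh (s + t) = dcosh s * dcosh t + dsinh s * dsinh t.
Proof. by rewrite /dcosh /dsinh opprD !expRD; ring. Qed.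

Lemma dsinhB s t : 2 * dsinh (s - t) = dsinh s * dcosh t - dcosh s * dsinh t.
Proof. by rewrite /dcosh /dsinh opprB !expRD; ring. Qed.

Lemma dcosh_nondecreasing s t : 0 <= s -> s <= t -> dcosh s <= dcosh t.
Proof.
move=> s0 st; apply: (@derivative_nondecreasing dcosh dsinh) => // x.
  by move=> _; exact: is_derive_dcosh1.
by move=> /andP[sx _]; rewrite dsinh_ge0//; lra.
Qed.

(** The numerator of the derivative is [dcosh x * dsinh (2 * (b * x)) - 4 * b * dsinh x],
    nonnegative since [y <= sinh y] at [y = 2 * b * x] and [tanh x <= x]. *)
Lemma dsinh_coth_nondecreasing b s t : 0 < b -> 0 < s -> s <= t ->
  dsinh s * (dcosh (b * s) / dsinh (b * s)) <=
  dsinh t * (dcosh (b * t) / dsinh (b * t)).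
Proof.
move=> b0 s0 st.
apply: (@derivative_nondecreasing (fun t => dsinh t * (dcosh (b * t) / dsinh (b * t)))
  (fun x => (dcosh x * (dcosh (b * x) * dsinh (b * x)) - 4 * b * dsinh x)
    / dsinh (b * x) ^+ 2)); first exact: st.
all: move=> x /andP[sx xt].
- have x0 : 0 < x by lra.
  have bx : dsinh (b * x) != 0 by rewrite gt_eqF// dsinh_gt0// mulr_gt0.
  have h := is_deriveM (is_derive_dsinh1 x)
    (is_deriveM (is_derive_dcosh b x)
      (@is_deriveV R (fun t => dsinh (b * t)) x _ _ bx (is_derive_dsinh b x))).
  apply: (is_derive_eq h); rewrite /GRing.scale /=.
  rewrite -[(_ * _ : R -> R) x]/(dcosh (b * x) * (dsinh (b * x))^-1).
  rewrite -(dcosh2_dsinh2 (b * x)); field.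
  done.
- have x0 : 0 < x by lra.
  rewrite divr_ge0 ?sqr_ge0// subr_ge0 dcosh_dsinh_double.
  have h1 := dsinh_le (ltW x0).
  have h2 : 2 * (2 * (b * x)) <= dsinh (2 * (b * x)).
    by apply: dsinh_ge; rewrite !mulr_ge0// ltW.
  have h3 := dcosh_gt0 x.
  apply: (@le_trans _ _ (dcosh x * (2 * (2 * (b * x))))); last by rewrite ler_pM2l.
  by rewrite (_ : dcosh x * _ = 4 * b * (x * dcosh x)); [rewrite ler_pM2l//; lra|ring].
Qed.

(* With [a = b + 1], the reciprocal of [(tanh (a t) - tanh t) / (sech t * tanh t)], the derivative
   of the Renyi function in the variable [sech t], up to a factor. *)
Definition renyi_slope_inv b t :=
  dcosh ((b + 1) * t) * dsinh t / (dsinh (b * t) * dcosh t).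

(** The addition formula for [dcosh ((b + 1) * x)] splits off the function of the previous lemma;
    the other term, [dsinh x ^+ 2 / dcosh x], is [dcosh x - 4 / dcosh x]. *)
Lemma renyi_slope_inv_nondecreasing b s t : 0 < b -> 0 < s -> s <= t ->
  renyi_slope_inv b s <= renyi_slope_inv b t.
Proof.
move=> b0 s0 st.
have E x : 0 < x -> renyi_slope_inv b x =
    (dsinh x * (dcosh (b * x) / dsinh (b * x)) + (dcosh x - 4 / dcosh x)) / 2.
  move=> x0; rewrite /renyi_slope_inv.
  have -> : dcosh ((b + 1) * x) = (dcosh (b * x) * dcosh x + dsinh (b * x) * dsinh x) / 2.
    by rewrite -dcoshD mulrDl mul1r; field.
  have bx : dsinh (b * x) != 0 by rewrite gt_eqF// dsinh_gt0// mulr_gt0.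
  have cx : dcosh x != 0 by rewrite gt_eqF// dcosh_gt0.
  rewrite -(dcosh2_dsinh2 x); field.
  by rewrite bx cx.
have t0 : 0 < t by lra.
rewrite !E// ler_pM2r ?invr_gt0 ?ltr0n// lerD ?dsinh_coth_nondecreasing//.
have cst := dcosh_nondecreasing (ltW s0) st.
by rewrite lerB// ler_pM2l ?ltr0n// lef_pV2// posrE dcosh_gt0.
Qed.
End Hyperbolic.

(** * Convexity of the Renyi function *)

Section RenyiFunction.
Context {R : realType}.
Implicit Types (x t b k c : R).

(** This is [ln 2 * f_renyi (b + 1) x] at [x = 2 / dcosh t], where the eigenvalues are
    [expR t / dcosh t] and [expR (- t) / dcosh t]. *)
Definition renyi_sech b t : R :=
  ((b + 1) * ln (dcosh t) - ln (dcosh ((b + 1) * t))) / b.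

Lemma is_derive_ln_dcosh (a x : R) :
  is_derive x 1 (fun t : R => ln (dcosh (a * t))) (a * dsinh (a * x) / dcosh (a * x)).
Proof.
rewrite mulrC; apply: (@is_derive1_comp R (@ln R) (fun t => dcosh (a * t))).
  exact/is_derive1_ln/dcosh_gt0.
exact: is_derive_dcosh.
Qed.

(** A supporting line in the variable [2 / dcosh t]: for [t > 0], the derivative of the difference
    [F] has the sign of [renyi_slope_inv b t - renyi_slope_inv b t0], so [F] is least at [t0]. *)
Lemma renyi_sech_tangent b t0 : 0 < b -> 0 < t0 -> exists2 k, 0 <= k &
  forall t, 0 <= t ->
    renyi_sech b t0 - k * (2 / dcosh t0) <= renyi_sech b t - k * (2 / dcosh t).
Proof.
move=> b0 t00; pose a := b + 1.
have a0 : 0 < a by rewrite /a; lra.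
have g0 t : 0 < t -> 0 < renyi_slope_inv b t.
  move=> ?; rewrite divr_gt0 ?mulr_gt0 ?dcosh_gt0 ?dsinh_gt0 ?mulr_gt0//.
(* Chosen so that [F'] vanishes at [t0]. *)
pose k := a / b / renyi_slope_inv b t0.
have k0 : 0 <= k by apply/ltW/divr_gt0; [exact: divr_gt0|exact: g0].
exists k => //.
pose F t := renyi_sech b t - k * (2 / dcosh t).
pose F' t := (a * (dsinh t / dcosh t) - a * dsinh (a * t) / dcosh (a * t)) / b +
  2 * k * (dsinh t / dcosh t ^+ 2).
have dF x : is_derive x 1 F (F' x).
  have c0 : dcosh x != 0 by rewrite gt_eqF// dcosh_gt0.
  have h1 := is_derive_ln_dcosh 1 x.
  have {}h1 : is_derive x 1 (fun t : R => ln (dcosh t)) (dsinh x / dcosh x).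
    by move: h1; under eq_fun do rewrite mul1r; rewrite !mul1r.
  have h2 := is_deriveB (is_deriveZ a h1) (is_derive_ln_dcosh a x).
  have h3 := is_deriveZ b^-1 h2.
  have h4 := @is_deriveV R dcosh x _ _ c0 (is_derive_dcosh1 x).
  have h5 := is_deriveB h3 (is_deriveZ (k * 2) h4).
  have -> : F = b^-1 *: (a *: (fun t => ln (dcosh t)) - (fun t => ln (dcosh (a * t))))
      - (k * 2) *: (fun t => (dcosh t)^-1).
    by apply/funext => t; rewrite /F /renyi_sech /= mulrC mulrA.
  apply: (is_derive_eq h5); rewrite /GRing.scale /= /F'; field.
  by rewrite !gt_eqF ?dcosh_gt0.
have F'E t : 0 < t -> F' t = 2 * dsinh (b * t) / (dcosh t * dcosh (a * t)) *
    (k * (renyi_slope_inv b t - renyi_slope_inv b t0)).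
  move=> tp.
  have E : 2 * dsinh (b * t) = dsinh (a * t) * dcosh t - dcosh (a * t) * dsinh t.
    by rewrite -dsinhB; congr (2 * dsinh _); rewrite /a; ring.
  have kE : k * renyi_slope_inv b t0 = a / b by rewrite /k; field; rewrite !gt_eqF ?g0.
  rewrite (mulrBr k) kE /renyi_slope_inv -/a.
  transitivity (2 * k * (dsinh t / dcosh t ^+ 2)
    - (a / b) * (2 * dsinh (b * t) / (dcosh t * dcosh (a * t)))).
    by rewrite /F' E; field; rewrite !gt_eqF ?dcosh_gt0.
  by field; rewrite !gt_eqF ?dcosh_gt0 ?dsinh_gt0 ?mulr_gt0.
have pre t : 0 < t -> 0 <= 2 * dsinh (b * t) / (dcosh t * dcosh (a * t)).
  by move=> ?; rewrite divr_ge0 ?mulr_ge0 ?dsinh_ge0 ?ltW ?dcosh_gt0// mulr_gt0.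
have F'0 : F' 0 = 0 by rewrite /F' mulr0 dsinh0 !(mul0r, mulr0) subrr mul0r add0r.
move=> t tp; have [tt0|t0t] := leP t t0.
  rewrite -lerN2; apply: (@derivative_nondecreasing _ (fun t => - F t)
    (fun t => - F' t)) => // x.
  move=> /andP[tx xt]; rewrite oppr_ge0.
  have [x0|x0] := eqVneq x 0; first by rewrite x0 F'0.
  have xp : 0 < x by rewrite lt_neqAle eq_sym x0 (le_trans tp).
  rewrite F'E// mulr_ge0_le0 ?pre// mulr_ge0_le0// subr_le0.
  exact: renyi_slope_inv_nondecreasing.
apply: (@derivative_nondecreasing _ F F') => [|x /andP[tx xt]]; first exact: ltW.
have xp : 0 < x by rewrite (lt_le_trans t00).
by rewrite F'E// mulr_ge0 ?pre// mulr_ge0// subr_ge0 renyi_slope_inv_nondecreasing.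
Qed.

Lemma f_renyi_sech b x : 0 < b -> 0 < x -> x <= 1 -> exists t,
  [/\ 0 <= t, x = 2 / dcosh t, f_renyi (b + 1) x = renyi_sech b t / ln 2
    & x < 1 -> 0 < t].
Proof.
move=> b0 x0 x1; set s := Num.sqrt (1 - x ^+ 2).
have x2 : 0 <= 1 - x ^+ 2 by rewrite subr_ge0 expr_le1// ltW.
have s2 : s ^+ 2 = 1 - x ^+ 2 by rewrite sqr_sqrtr.
have s0 : 0 <= s by rewrite sqrtr_ge0.
have sx : 0 < (1 + s) / x by rewrite divr_gt0//; lra.
(* This is arcosh of [x^-1]; as [(1 + s) * (1 - s) = x ^+ 2], the opposite exponential is
   [(1 - s) / x]. *)
pose t := ln ((1 + s) / x).
have et : expR t = (1 + s) / x by rewrite lnK.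
have xn : x != 0 by rewrite gt_eqF.
have sn : 1 + s != 0 by rewrite gt_eqF//; lra.
have eNt : expR (- t) = (1 - s) / x.
  rewrite expRN et invf_div; apply: (mulIf sn); rewrite mulfVK//.
  by apply: (mulIf xn); rewrite mulrAC mulfVK//; ring: s2.
have ct : dcosh t = 2 / x by rewrite /dcosh et eNt; field.
have c0 := dcosh_gt0 t.
have xc : x = 2 / dcosh t by rewrite ct; field.
have t0 : 0 <= t.
  rewrite ln_ge0// ler_pdivlMr//; lra.
exists t; split=> //.
  have pE (u y : R) : expR y / dcosh t = u ->
      u `^ (b + 1) = expR ((b + 1) * y) * expR (- (b + 1) * ln (dcosh t)).
    move=> <-; rewrite /powR gt_eqF ?divr_gt0 ?expR_gt0// ln_div ?posrE ?expR_gt0//.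
    by rewrite expRK -expRD; congr expR; ring.
  rewrite /f_renyi -/s gt_eqF; last by lra.
  rewrite (pE ((1 + s) / 2) t) ?et ?ct; last by field.
  rewrite (pE ((1 - s) / 2) (- t)) ?eNt ?ct; last by field.
  rewrite -ct -mulrDl mulrN [X in X * expR _]addrC -/(dcosh _) /log2.
  rewrite lnM ?posrE ?dcosh_gt0 ?expR_gt0//.
  rewrite expRK /renyi_sech (_ : 1 - (b + 1) = - b); last by ring.
  have l2 : ln 2 != 0 :> R by rewrite gt_eqF// ln_gt0// ltr1n.
  by field; rewrite l2 gt_eqF.
move=> xlt1; rewrite ln_gt0// ltr_pdivlMr//; lra.
Qed.

Lemma f_renyi0 (a : R) : 1 <= a -> f_renyi a 0 = 0.
Proof.
move=> a1; rewrite /f_renyi expr0n subr0 sqrtr1 subrr mul0r.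
have -> : (1 + 1) / 2 = 1 :> R by field.
have a0 : a != 0 by rewrite gt_eqF// (lt_le_trans ltr01).
case: eqP => [_|_]; last by rewrite powR0// powR1 add0r /log2 ln1 mul0r mulr0.
rewrite /binary_entropy /log2 mulr1 (_ : 1 / 2 + 1 / 2 = 1); last by field.
by rewrite ln1 subrr !(mul0r, mulr0) oppr0 addr0.
Qed.

Lemma f_renyi_ge0 b x : 0 < b -> 0 <= x <= 1 -> 0 <= f_renyi (b + 1) x.
Proof.
move=> b0 /andP[]; rewrite le_eqVlt => /predU1P[<- _|x0 x1].
  by rewrite f_renyi0//; lra.
rewrite /f_renyi gt_eqF; last by lra.
set s := Num.sqrt (1 - x ^+ 2).
have s0 : 0 <= s by rewrite sqrtr_ge0.
have s1 : s < 1.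
  by rewrite -(@sqrtr1 R) ltr_sqrt// gtrBl exprn_gt0.
have p1 : ((1 - s) / 2) `^ (b + 1) <= (1 - s) / 2 by apply: ge1r_powR; lra.
have q1 : ((1 + s) / 2) `^ (b + 1) <= (1 + s) / 2 by apply: ge1r_powR; lra.
rewrite mulr_le0// ?invr_le0; first by lra.
rewrite /log2 pmulr_lle0 ?invr_gt0 ?ln_gt0 ?ltr1n//.
by apply: ln_le0; lra.
Qed.

(** Controls [f_renyi] near 0, a point that [2 / dcosh t] never reaches. The ingredients are
    [ln (dcosh t) <= t + expR (- t) ^+ 2], [(b + 1) * t <= ln (dcosh ((b + 1) * t))] and
    [expR (- t) <= x]. *)
Lemma f_renyi_le_sqr b x : 0 < b -> 0 < x -> x <= 1 ->
  f_renyi (b + 1) x <= (b + 1) / b / ln 2 * x ^+ 2.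
Proof.
move=> b0 x0 x1; have [t [t0 xt -> _]] := f_renyi_sech b0 x0 x1.
have l2 : 0 < ln 2 :> R by rewrite ln_gt0// ltr1n.
have e1 : ln (dcosh t) <= t + expR (- t) ^+ 2.
  have -> : dcosh t = expR t * (1 + expR (- t) ^+ 2).
    by rewrite /dcosh mulrDr expr2 mulrA -expRD subrr expR0 mul1r mulr1.
  rewrite lnM ?posrE ?expR_gt0 ?addr_gt0 ?exprn_gt0 ?expR_gt0// expRK lerD2l.
  by rewrite le_ln1Dx// (lt_trans (ltrN10 _))// exprn_gt0 ?expR_gt0.
have e2 : (b + 1) * t <= ln (dcosh ((b + 1) * t)).
  rewrite -[X in X <= _]expRK ler_ln ?posrE ?expR_gt0 ?dcosh_gt0//.
  by rewrite lerDl expR_ge0.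
have e3 : expR (- t) ^+ 2 <= x ^+ 2.
  suff ex : expR (- t) <= x by rewrite lerXn2r ?nnegrE ?expR_ge0// ltW.
  rewrite xt ler_pdivlMr ?dcosh_gt0// /dcosh mulrDr -!expRD addNr expR0.
  have : expR (- t - t) <= 1 :> R by rewrite -expR0 ler_expR; lra.
  by lra.
rewrite -[X in _ <= X]mulrAC ler_pM2r ?invr_gt0// /renyi_sech mulrAC ler_pM2r ?invr_gt0//.
have : (b + 1) * ln (dcosh t) <= (b + 1) * (t + x ^+ 2).
  by rewrite ler_pM2l; lra.
by lra.
Qed.

Lemma le0_of_le_sqr (K d : R) : 0 < K ->
  (forall y, 0 < y -> y <= 1 -> d <= K * y ^+ 2) -> d <= 0.
Proof.
move=> K0 h; rewrite leNgt; apply/negP => d0.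
have K2 : 0 < 2 * K by rewrite mulr_gt0.
(* Then [K * y ^+ 2 <= K * y <= d / 2], contradicting [d <= K * y ^+ 2]. *)
pose y := Num.min 1 (d / (2 * K)).
have y0 : 0 < y by rewrite lt_min ltr01 divr_gt0.
have y1 : y <= 1 by rewrite ge_min lexx.
have yd : y * (2 * K) <= d by rewrite -ler_pdivlMr// /y ge_min lexx orbT.
have h1 := h y y0 y1.
have h2 : K * y ^+ 2 <= K * y by rewrite ler_pM2l// expr2 ger_pMl.
rewrite mulrCA (mulrC y) in yd; clearbody y; lra.
Qed.

Lemma f_renyi_tangent b c : 0 < b -> 0 < c < 1 -> exists2 k, 0 <= k &
  forall x, 0 <= x <= 1 -> f_renyi (b + 1) c + k * (x - c) <= f_renyi (b + 1) x.
Proof.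
move=> b0 /andP[c0 c1]; have l2 : 0 < ln 2 :> R by rewrite ln_gt0// ltr1n.
have [t0 [_ cE fc /(_ c1) t00]] := f_renyi_sech b0 c0 (ltW c1).
have [k k0 kt] := renyi_sech_tangent b0 t00.
exists (k / ln 2); first by rewrite divr_ge0// ltW.
have pos x : 0 < x <= 1 -> f_renyi (b + 1) c + k / ln 2 * (x - c) <= f_renyi (b + 1) x.
  move=> /andP[x0 x1]; have [t [tp xE -> _]] := f_renyi_sech b0 x0 x1.
  have := kt t tp; rewrite -cE -xE fc => h.
  by rewrite (mulrAC k) -mulrDl ler_pM2r ?invr_gt0//; lra.
move=> x /andP[]; rewrite le_eqVlt => /predU1P[<- _|x0 x1];
  last by apply: pos; rewrite x0.
rewrite f_renyi0; last by lra.
have K0 : 0 < (b + 1) / b / ln 2 by rewrite !divr_gt0//; lra.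
(* The inequality at 0 comes from [pos] at arbitrarily small [y]. *)
apply: (le0_of_le_sqr K0) => y y0 y1.
apply: le_trans (f_renyi_le_sqr b0 y0 y1); have := pos y; rewrite y0 y1 => /(_ isT).
apply: le_trans; rewrite lerD2l; apply: ler_wpM2l; first exact: divr_ge0 k0 (ltW l2).
by rewrite lerD2r ltW.
Qed.

(** Supporting lines are given at interior points only. At [c = 0] nonnegativity suffices; at
    [c = 1] every [x i] of positive weight is 1. As slopes are nonnegative, an average above [c] is
    enough. *)
Lemma jensen_of_tangent (f : R -> R) c n (p x : 'I_n -> R) :
  f 0 = 0 -> (forall y, 0 <= y <= 1 -> 0 <= f y) ->
  (0 < c < 1 -> exists2 k, 0 <= k &
    forall y, 0 <= y <= 1 -> f c + k * (y - c) <= f y) ->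
  0 <= c <= 1 -> (forall i, 0 <= p i) -> \sum_i p i = 1 ->
  (forall i, 0 <= x i <= 1) -> c <= \sum_i p i * x i ->
  f c <= \sum_i p i * f (x i).
Proof.
move=> f0 fpos tgt /andP[c0 c1] p0 p1 x01 cx.
have [->|cn0] := eqVneq c 0.
  by rewrite f0 sumr_ge0// => i _; rewrite mulr_ge0 ?fpos.
have [ce1|cn1] := eqVneq c 1.
  have /eqP : \sum_i p i * (1 - x i) = 0.
    apply/eqP; rewrite eq_le; apply/andP; split; last first.
      by rewrite sumr_ge0// => i _; rewrite mulr_ge0// subr_ge0; case/andP: (x01 i).
    under eq_bigr do rewrite mulrBr mulr1.
    by rewrite sumrB p1 subr_le0 -ce1.
  rewrite psumr_eq0 => [/allP px|i _]; last first.
    by rewrite mulr_ge0// subr_ge0; case/andP: (x01 i).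
  rewrite -[X in X <= _]mul1r -p1 mulr_suml ler_sum// => i _.
  have := px i; rewrite mem_index_enum mulf_eq0 subr_eq0 => /(_ isT)/orP[/eqP ->|/eqP <-].
    by rewrite !mul0r.
  by rewrite ce1.
have [|k k0 kx] := tgt; first by rewrite !lt_neqAle c0 c1 cn1 eq_sym cn0.
apply: (@le_trans _ _ (\sum_i p i * (f c + k * (x i - c)))); last first.
  by apply: ler_sum => i _; rewrite ler_wpM2l ?kx.
have -> : \sum_i p i * (f c + k * (x i - c)) = f c + k * (\sum_i p i * x i - c).
  transitivity (\sum_i ((f c - k * c) * p i + k * (p i * x i))).
    by apply: eq_bigr => i _; ring.
  by rewrite big_split /= -!mulr_sumr p1; ring.
by rewrite lerDl mulr_ge0// subr_ge0.
Qed.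

Lemma f_renyi_jensen (a : R) c n (p x : 'I_n -> R) : 1 <= a -> 0 <= c <= 1 ->
  (forall i, 0 <= p i) -> \sum_i p i = 1 -> (forall i, 0 <= x i <= 1) ->
  c <= \sum_i p i * x i -> f_renyi a c <= \sum_i p i * f_renyi a (x i).
Proof.
move=> a1 c01 p0 p1 x01 cx.
have J (a' : R) : 1 < a' -> f_renyi a' c <= \sum_i p i * f_renyi a' (x i).
  move=> a'1; have b0 : 0 < a' - 1 by rewrite subr_gt0.
  rewrite -[a'](subrK 1); apply: jensen_of_tangent c01 p0 p1 x01 cx.
  - by apply: f_renyi0; rewrite subrK ltW.
  - by move=> y y01; exact: f_renyi_ge0.
  - by move=> c01'; exact: f_renyi_tangent.
(* For [a = 1] the inequality passes to the limit from the right by [f_renyi_cvg1]. *)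
move: a1; rewrite le_eqVlt => /predU1P[<-|]; last exact: J.
have cv y : 0 <= y <= 1 -> f_renyi a y @[a --> (1 : R)^'+] --> f_renyi 1 y.
  by move=> y01; apply: cvg_dnbhs_at_right; exact: f_renyi_cvg1.
apply: (@ler_cvg_to _ ((1 : R)^'+) _ _ (fun a => f_renyi a c)
  (fun a => \sum_i p i * f_renyi a (x i))).
- exact: cv.
- apply: cvg_big => [|i _]; first exact: add_continuous.
   apply: cvgMr; exact: cv.
- near=> a'; apply: J; near: a'; exact: nbhs_right_gt.
Unshelve. all: by end_near. Qed.
End RenyiFunction.

(** * Pure two-qubit states *)

Local Open Scope complex_scope.

Section PureStates.
Context {R : realType}.
Notation C := R[i].
Implicit Types psi : 'cV[C]_(2 * 2).

(* [sigma_y *t sigma_y], up to sign. *)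
Definition spin_flip : 'M[C]_(2 * 2) :=
  \matrix_(i, j) ((-1) ^+ (0 < i < 3)%N * (i + j == 3)%N%:R).

Lemma spin_flip_sym : spin_flip^T = spin_flip.
Proof.
by apply/matrixP => -[[|[|[|[|//]]]] ?] [[|[|[|[|//]]]] ?]; rewrite !mxE /= ?mulr0.
Qed.

(** Bilinear, with no conjugation: twice the determinant of the coefficient matrix of [psi]. *)
Definition flip_overlap psi : C := (psi^T *m spin_flip *m psi) 0 0.

Local Notation i00 := (mxtens_index (0, 0) : 'I_(2 * 2)).
Local Notation i01 := (mxtens_index (0, 1) : 'I_(2 * 2)).
Local Notation i10 := (mxtens_index (1, 0) : 'I_(2 * 2)).
Local Notation i11 := (mxtens_index (1, 1) : 'I_(2 * 2)).

Lemma sum_two_qubits (V : nmodType) (f : 'I_(2 * 2) -> V) :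
  \sum_i f i = f i00 + f i01 + f i10 + f i11.
Proof.
rewrite !big_ord_recl big_ord0 addr0 !addrA.
by do !congr (_ + _); congr f; apply/val_inj.
Qed.

Lemma flip_overlapE psi :
  flip_overlap psi = 2 * (psi i00 0 * psi i11 0 - psi i01 0 * psi i10 0).
Proof.
rewrite /flip_overlap mxE sum_two_qubits !mxE !sum_two_qubits !mxE /=.
by rewrite !expr0 !expr1 !(mulr0, mulr1, addr0, add0r); ring.
Qed.

Lemma ord2_sum (V : nmodType) (f : 'I_2 -> V) : \sum_i f i = f 0 + f 1.
Proof.
by rewrite !big_ord_recl big_ord0 addr0; congr (_ + f _); apply/val_inj.
Qed.

Lemma trB_ketbraE psi i j : trB (ketbra psi) i j =
  psi (mxtens_index (i, 0)) 0 * conjC (psi (mxtens_index (j, 0)) 0) +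
  psi (mxtens_index (i, 1)) 0 * conjC (psi (mxtens_index (j, 1)) 0).
Proof.
have kE k l : ketbra psi k l = psi k 0 * conjC (psi l 0).
  by rewrite mxE big_ord1 !mxE.
by rewrite mxE ord2_sum !kE.
Qed.

Lemma trB_ketbra_herm psi : trB (ketbra psi) \is hermsymmx.
Proof.
apply/is_hermitianmxP; rewrite expr0 scale1r; apply/matrixP => i j.
rewrite [RHS]mxE [_^T _ _]mxE !trB_ketbraE rmorphD !rmorphM /= !conjCK.
by rewrite mulrC [X in _ + X]mulrC.
Qed.

Lemma unit_vectorE psi : unit_vector psi ->
  psi i00 0 * conjC (psi i00 0) + psi i01 0 * conjC (psi i01 0) +
  psi i10 0 * conjC (psi i10 0) + psi i11 0 * conjC (psi i11 0) = 1.
Proof.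
rewrite /unit_vector mxE sum_two_qubits !mxE => <-.
by do !congr (_ + _); rewrite mulrC.
Qed.

Lemma tr_trB_ketbra psi : unit_vector psi -> \tr (trB (ketbra psi)) = 1.
Proof. by move/unit_vectorE => <-; rewrite /mxtrace ord2_sum !trB_ketbraE addrA. Qed.

(** Both sides are four times the determinant of the reduced state, which is the squared modulus of
    the determinant of the coefficients. *)
Lemma tr_trB_ketbra_sqr psi : unit_vector psi ->
  2 * (1 - \tr (trB (ketbra psi) *m trB (ketbra psi))) = `|flip_overlap psi| ^+ 2.
Proof.
move/unit_vectorE => u; rewrite /mxtrace ord2_sum !mxE !ord2_sum !trB_ketbraE.
rewrite normCK flip_overlapE rmorphM rmorphB !rmorphM /= conjC_nat.
move: u; set a := psi i00 0; set b := psi i01 0; set c := psi i10 0; set d := psi i11 0.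
(* With conjugates as independent variables and 1 replaced by the square of the normalisation sum, a
   polynomial identity remains. *)
move: (conjC a) (conjC b) (conjC c) (conjC d) => a' b' c' d' u.
rewrite (_ : forall x, 2 * (1 - x) = 2 * ((a * a' + b * b' + c * c' + d * d') ^+ 2 - x)).
  by ring.
by move=> x; rewrite u expr1n.
Qed.

Lemma pure_concurrenceE psi : unit_vector psi ->
  (pure_concurrence psi)%:C = `|flip_overlap psi|.
Proof.
move=> /tr_trB_ketbra_sqr u; rewrite /pure_concurrence.
have -> : 2 * (1 - complex.Re (\tr (trB (ketbra psi) *m trB (ketbra psi)))) =
    complex.Re `|flip_overlap psi| ^+ 2.
  have /(congr1 (@complex.Re R)) := u.
  have := RRe_real (normr_real (flip_overlap psi)).
  set r := complex.Re `|_| => <-; rewrite -rmorphXn /= => <-.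
  by case: (\tr _) => x y /=; ring.
have h := RRe_real (normr_real (flip_overlap psi)).
rewrite sqrtr_sqr ger0_norm ?h// -ler0c h normr_ge0 //.
Qed.

Lemma tr_mxfun n (f : R -> R) (A : 'M[C]_n) :
  \tr (mxfun f A) = (\sum_i f (complex.Re (spectral_diag A 0 i)))%:C.
Proof.
rewrite /mxfun mxtrace_mulC mulmxA mulmxV ?spectral_unit// mul1mx mxtrace_diag.
by rewrite rmorph_sum; apply: eq_bigr => i _; rewrite mxE.
Qed.

Lemma tr_mul_mxfun n (f : R -> R) (A : 'M[C]_n) : A \is hermsymmx ->
  \tr (A *m mxfun f A) =
  (\sum_i complex.Re (spectral_diag A 0 i) * f (complex.Re (spectral_diag A 0 i)))%:C.
Proof.
move=> hA; have rD := hermitian_spectral_diag_real hA.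
have /hermitian_normalmx/orthomx_spectralP AE := hA.
rewrite {1}AE /mxfun; set P := spectralmx A; set D := spectral_diag A in rD *.
have uP : P \in unitmx by exact: spectral_unit.
rewrite -!mulmxA mxtrace_mulC !mulmxA mulmxK// mulmxK//.
rewrite mulmx_diag mxtrace_diag rmorph_sum; apply: eq_bigr => i _.
by rewrite !mxE rmorphM /= RRe_real//; apply/mxOverP.
Qed.

Lemma pure_eigenvalues psi : unit_vector psi -> exists x0 x1 : R,
  [/\ x0 + x1 = 1, pure_concurrence psi ^+ 2 = 1 - (x0 - x1) ^+ 2,
    forall f, \tr (mxfun f (trB (ketbra psi))) = (f x0 + f x1)%:C &
    forall f, \tr (trB (ketbra psi) *m mxfun f (trB (ketbra psi))) =
      (x0 * f x0 + x1 * f x1)%:C].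
Proof.
move=> u; set A := trB (ketbra psi); have hA : A \is hermsymmx := trB_ketbra_herm psi.
have rD := hermitian_spectral_diag_real hA.
have /hermitian_normalmx/orthomx_spectralP AE := hA.
set D := spectral_diag A in rD AE.
(* Taking [f = id] in the trace formulas below yields the traces of [A] and [A *m A]. *)
have mid : mxfun id A = A.
  rewrite /mxfun (_ : map_mx _ _ = D) -?AE//.
  by apply/rowP => i; rewrite mxE RRe_real//; apply/mxOverP.
have tE f : \tr (mxfun f A) = (f (complex.Re (D 0 0)) + f (complex.Re (D 0 1)))%:C.
  by rewrite tr_mxfun ord2_sum.
have t2E f : \tr (A *m mxfun f A) = (complex.Re (D 0 0) * f (complex.Re (D 0 0)) +
    complex.Re (D 0 1) * f (complex.Re (D 0 1)))%:C.
  by rewrite tr_mul_mxfun// ord2_sum.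
exists (complex.Re (D 0 0)), (complex.Re (D 0 1)).
set x0 := complex.Re _ in tE t2E *; set x1 := complex.Re _ in tE t2E *.
have x01 : x0 + x1 = 1.
  by apply: complexI; rewrite -(tE id) mid tr_trB_ketbra.
split=> //; apply: complexI.
rewrite rmorphXn /= pure_concurrenceE// -tr_trB_ketbra_sqr// -/A -[X in A *m X]mid t2E.
have -> : 1 - (x0 - x1) ^+ 2 = 2 * (1 - (x0 * x0 + x1 * x1)).
  by rewrite (_ : x1 = 1 - x0); [ring|lra].
by rewrite rmorphM rmorphB /= rmorph_nat.
Qed.

Lemma pure_concurrence_bounds psi : unit_vector psi -> 0 <= pure_concurrence psi <= 1.
Proof.
move=> /pure_eigenvalues[x0 [x1 [_ c2 _ _]]]; rewrite sqrtr_ge0 /=.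
rewrite -(@expr_le1 _ 2)// ?sqrtr_ge0// c2 gerBl sqr_ge0 //.
Qed.

(** The square root in [f_renyi] is the absolute gap between the eigenvalues, so its arguments are
    the eigenvalues themselves, in an order fixed by the sign of the gap. *)
Lemma pure_renyiE (alpha : R) psi : unit_vector psi ->
  pure_renyi_entanglement alpha psi = f_renyi alpha (pure_concurrence psi).
Proof.
move=> /pure_eigenvalues[x0 [x1 [x01 c2 tE t2E]]].
rewrite /pure_renyi_entanglement /renyi_entropy /f_renyi.
rewrite /von_neumann_entropy c2 tE t2E /=.
rewrite opprB addrCA subrr addr0 sqrtr_sqr /binary_entropy.
have [h|h] := leP 0 (x0 - x1); [rewrite ger0_norm//|rewrite ltr0_norm//];
  case: ifP => _.
- have -> : 1 / 2 + 1 / 2 * (x0 - x1) = x0 by lra.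
  have -> : 1 - x0 = x1 by lra.
  by rewrite opprD.
- have -> : (1 - (x0 - x1)) / 2 = x1 by lra.
  have -> : (1 + (x0 - x1)) / 2 = x0 by lra.
  by rewrite [X in log2 X]addrC.
- have -> : 1 / 2 + 1 / 2 * (- (x0 - x1)) = x1 by lra.
  have -> : 1 - x1 = x0 by lra.
  by rewrite opprD addrC.
- have -> : (1 - - (x0 - x1)) / 2 = x0 by lra.
  have -> : (1 + - (x0 - x1)) / 2 = x1 by lra.
  by [].
Qed.
End PureStates.

(** * Mixed two-qubit states *)

Section Ensembles.
Context {R : realType}.
Notation C := R[i].

Lemma mul_adj_sum_ketbra n K (W : 'M[C]_(n, K)) :
  W *m W^t* = \sum_k ketbra (col k W).
Proof.
apply/matrixP => i j; rewrite mxE summxE; apply: eq_bigr => k _.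
by rewrite [RHS]mxE big_ord1 !mxE.
Qed.

Lemma ketbraZ n (r : R) (psi : 'cV[C]_n) :
  ketbra (r%:C *: psi) = (r ^+ 2)%:C *: ketbra psi.
Proof.
rewrite /ketbra; apply/matrixP => i j; rewrite !mxE !big_ord1 !mxE.
have rr : conjC r%:C = r%:C by exact: conjc_real.
by rewrite rmorphM /= rr rmorphXn /=; ring.
Qed.

Lemma flip_overlapZ (r : C) (psi : 'cV[C]_(2 * 2)) :
  flip_overlap (r *: psi) = r ^+ 2 * flip_overlap psi.
Proof.
by rewrite /flip_overlap [(_ *: _)^T]linearZ /= -!scalemxAl -scalemxAr scalerA mxE -expr2.
Qed.

Lemma flip_overlap_col K (W : 'M[C]_(2 * 2, K)) k :
  (W^T *m spin_flip *m W) k k = flip_overlap (col k W).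
Proof.
by rewrite -[X in _ *m X]trmxK mxform_row /mxform -!tr_col !trmxK.
Qed.

(** Absorbing the weights into the columns turns a decomposition of [rho] into a matrix [W] with
    [W *m W^t* = rho]. *)
Definition ensemble_mx n K (p : 'I_K -> R) (psi : 'I_K -> 'cV[C]_n) : 'M[C]_(n, K) :=
  \matrix_(i, k) ((Num.sqrt (p k))%:C *: psi k) i 0.

Lemma col_ensemble_mx n K (p : 'I_K -> R) (psi : 'I_K -> 'cV[C]_n) k :
  col k (ensemble_mx p psi) = (Num.sqrt (p k))%:C *: psi k.
Proof. by apply/colP => i; rewrite !mxE. Qed.

Lemma ensemble_mxP n (rho : 'M[C]_n) K (p : 'I_K -> R) (psi : 'I_K -> 'cV[C]_n) :
  pure_decomposition rho p psi ->
  ensemble_mx p psi *m (ensemble_mx p psi)^t* = rho.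
Proof.
case=> p0 _ _ ->; rewrite mul_adj_sum_ketbra; apply: eq_bigr => k _.
by rewrite col_ensemble_mx ketbraZ sqr_sqrtr.
Qed.

Lemma average_concurrenceE (rho : 'M[C]_(2 * 2)) K (p : 'I_K -> R)
    (psi : 'I_K -> 'cV[C]_(2 * 2)) (W := ensemble_mx p psi) :
  pure_decomposition rho p psi ->
  (\sum_k p k * pure_concurrence (psi k))%:C =
  \sum_k `|(W^T *m spin_flip *m W) k k|.
Proof.
case=> p0 _ u _; rewrite rmorph_sum; apply: eq_bigr => k _.
rewrite flip_overlap_col col_ensemble_mx flip_overlapZ -rmorphXn /= sqr_sqrtr//.
by rewrite normrM rmorphM /= pure_concurrenceE// [`|(p k)%:C|]ger0_norm ?ler0c.
Qed.

(** The weights are the squared norms of the columns of [Z]; normalising a column divides its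
    overlap by its weight. *)
Lemma equal_concurrence_decomposition (rho Z : 'M[C]_(2 * 2)) (c : R) :
  \tr rho = 1 -> Z *m Z^t* = rho ->
  (forall k, `|(Z^T *m spin_flip *m Z) k k| = c%:C * (Z^t* *m Z) k k) ->
  exists (p : 'I_(2 * 2) -> R) (psi : 'I_(2 * 2) -> 'cV[C]_(2 * 2)),
    pure_decomposition rho p psi /\
    forall k, p k = 0 \/ pure_concurrence (psi k) = c.
Proof.
move=> tr1 ZZ Zc.
pose p (k : 'I_(2 * 2)) := complex.Re ((Z^t* *m Z) k k).
have Z0 k : 0 <= (Z^t* *m Z) k k.
  by rewrite mxE sumr_ge0// => i _; rewrite !mxE mulrC mul_conjC_ge0.
have pE k : (p k)%:C = (Z^t* *m Z) k k by rewrite RRe_real// ger0_real.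
have p0 k : 0 <= p k by rewrite -ler0c pE.
have normE k : ((col k Z)^t* *m col k Z) 0 0 = (p k)%:C.
  by rewrite pE !mxE; apply: eq_bigr => i _; rewrite !mxE.
have sum1 : \sum_k p k = 1.
  apply: complexI; rewrite rmorph_sum -[RHS]tr1 -ZZ mxtrace_mulC.
  by apply: eq_bigr => k _; rewrite /= pE.
have col0 k : p k = 0 -> col k Z = 0.
  move=> pk; have := normE k; rewrite pk => h.
  suff : (col k Z)^t* = 0.
    by move/(congr1 (fun M => M^t*)); rewrite trmxCK trmx0 map_mx0.
  apply: mul_adj_eq0; rewrite trmxCK; apply/matrixP => i j.
  by rewrite !ord1 h mxE.
(* A zero column has weight 0 and gets an arbitrary unit vector, whence the disjunction in the
   conclusion. *)
pose psi k : 'cV[C]_(2 * 2) :=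
  if p k == 0 then delta_mx 0 0 else ((Num.sqrt (p k))^-1)%:C *: col k Z.
have u k : unit_vector (psi k).
  rewrite /unit_vector /psi; case: eqP => [_|/eqP pk].
    by rewrite trmx_delta map_delta_mx mul_delta_mx mxE !eqxx.
  have -> : forall (r : R) (v : 'cV[C]_(2 * 2)),
      ((r%:C *: v)^t* *m (r%:C *: v)) 0 0 = (r ^+ 2)%:C * (v^t* *m v) 0 0.
    move=> r v; have rr : conjC r%:C = r%:C by exact: conjc_real.
    rewrite [(_ *: _)^T]linearZ /= map_mxZ /= rr.
    by rewrite -scalemxAl -scalemxAr scalerA mxE rmorphXn expr2.
  by rewrite normE exprVn sqr_sqrtr// -rmorphM /= mulVf.
exists p, psi; split; first split=> //.
  rewrite -ZZ mul_adj_sum_ketbra; apply: eq_bigr => k _.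
  rewrite /psi; case: eqP => [pk|/eqP pk].
    by rewrite col0// pk scale0r /ketbra mul0mx.
  by rewrite ketbraZ exprVn sqr_sqrtr// scalerA -rmorphM /= divff// scale1r.
move=> k; have [pk|pk] := eqVneq (p k) 0; [by left|right].
apply: complexI; rewrite pure_concurrenceE// /psi (negbTE pk) flip_overlapZ normrM.
rewrite -flip_overlap_col Zc -pE -rmorphXn /= exprVn sqr_sqrtr//.
rewrite ger0_norm ?ler0c ?invr_ge0// mulrCA -rmorphM /= mulVf//.
by rewrite rmorph1 mulr1.
Qed.

Lemma minimum_eq (A : set R) m : A m -> lbound A m -> minimum A = m.
Proof.
move=> Am lm; have [|mA lA] := @minimumP R A; first by exists m.
by apply/eqP; rewrite eq_le lA//= lm.
Qed.

End Ensembles.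

(** Existence of both minima is part of the claim, because [minimum] is meaningful only then. One
    ensemble, whose members of nonzero weight all have concurrence [r], attains both. *)
Theorem corollary1 (R : realType) (alpha : R) (rho : 'M[R[i]]_(2 * 2)) :
  1 <= alpha -> density_operator rho ->
  [/\ has_minimum (concurrence_averages rho),
      has_minimum (renyi_averages alpha rho)
    & renyi_entanglement alpha rho = f_renyi alpha (concurrence rho)].
Proof.
move=> a1 [hrho pos tr1].
have [c [c0 [Z ZZ Zc] lb]] := optimal_ensemble hrho pos tr1 (@spin_flip_sym R).
have [r cE] : exists r : R, c = r%:C.
  by exists (complex.Re c); rewrite RRe_real// ger0_real.
subst c.
have [p [psi [dec eqc]]] := equal_concurrence_decomposition tr1 ZZ Zc.
have [p0 p1 u _] := dec.
have avg (f : R -> R) : \sum_k p k * f (pure_concurrence (psi k)) = f r.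
  rewrite -[RHS]mul1r -p1 mulr_suml; apply: eq_bigr => k _.
  by case: (eqc k) => ->; rewrite ?mul0r.
have r01 : 0 <= r <= 1.
  rewrite -ler0c c0 -(avg id) -p1 ler_sum// => k _.
  by rewrite ler_piMr//; case/andP: (pure_concurrence_bounds (u k)).
have lbC K (q : 'I_K -> R) phi : pure_decomposition rho q phi ->
    r <= \sum_k q k * pure_concurrence (phi k).
  move=> d; rewrite -lecR (average_concurrenceE d).
  by apply: lb; exact: ensemble_mxP.
have memC : concurrence_averages rho r.
  by exists _, p, psi; split=> //; rewrite (avg id).
have lboundC : lbound (concurrence_averages rho) r.
  by move=> _ [K [q [phi [d ->]]]]; exact: lbC.
have memR : renyi_averages alpha rho (f_renyi alpha r).
  exists _, p, psi; split=> //; rewrite -(avg (f_renyi alpha)).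
  by apply: eq_bigr => k _; rewrite pure_renyiE.
have lboundR : lbound (renyi_averages alpha rho) (f_renyi alpha r).
  move=> _ [K [q [phi [d ->]]]]; have [q0 q1 uq _] := d.
  under eq_bigr do rewrite pure_renyiE//.
  apply: f_renyi_jensen => //; last exact: lbC.
  by move=> k; exact: pure_concurrence_bounds.
split; [by exists r | by exists (f_renyi alpha r) |].
by rewrite /renyi_entanglement /concurrence (minimum_eq memC) ?(minimum_eq memR).
Qed.
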